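(* Let $\Omega_0\subset\mathbb{R}^N$ be a smooth bounded domain, and for each $s\in[0,1]$ and $\omega\ge0$ let $$\mathcal{L}_\omega(\xi,s)=\sum_{i,j}\tilde a_{ij}(\xi,s)\frac{\partial^2}{\partial\xi_i\partial\xi_j}+\sum_j\left(\frac{\omega}{2\pi}\tilde b_j(\xi,s)+\tilde c_j(\xi,s)\right)\frac{\partial}{\partial\xi_j}$$ be the operator on $\Omega_0$ whose coefficients $\tilde a_{ij},\tilde b_j,\tilde c_j$ arise from a $1$-periodic domain $\tilde\Omega(s)$ and maps $\tilde h(\cdot,s)$ as described in the context. Assume that the coefficients $\tilde a_{ij},\tilde b_j,\tilde c_j$ belong to $C^{1+\alpha,1+\alpha}(\overline{\Omega_0}\times[0,1])$ for some $\alpha>0$. For $s\in[0,1]$ and $\omega\ge0$, let $\lambda^0(s,\omega)$ be the principal eigenvalue of the elliptic operator $-\mathcal{L}_\omega(\xi,s)$ on $\Omega_0$ with zero Dirichlet conditions on $\partial\Omega_0$. For $\omega>0$, let $\mu(\omega)$ be the principal periodic eigenvalue of the problem $$\frac{\omega}{2\pi}\frac{\partial\phi}{\partial s}-\mathcal{L}_\omega(\xi,s)\phi=\mu(\omega)\phi\quad(\xi\in\Omega_0,\ s\in[0,1]),$$ $$\phi(\xi,s)=0\quad(\xi\in\partial\Omega_0,\ s\in[0,1]),\qquad \phi(\xi,s)\equiv\phi(\xi,s+1)\quad(\xi\in\Omega_0).$$ Then $$\lim_{\omega\to0}\mu(\omega)=\int_0^1\lambda^0(s,0)\,ds .$$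
   Context: $D>0$ is a constant. $\tilde\Omega(s)\subset\mathbb{R}^N$, $s\in\mathbb{R}$, is a family of bounded connected domains with $\tilde\Omega(s+1)=\tilde\Omega(s)$, and $\tilde h(\cdot,s):\overline{\tilde\Omega(s)}\to\overline{\Omega_0}$ are one-to-one maps, $1$-periodic in $s$, transforming $\tilde\Omega(s)$ into the connected reference domain $\Omega_0$. The coefficients are $$\tilde a_{ij}(\xi,s)=\sum_kD\frac{\partial\tilde h_i}{\partial x_k}\frac{\partial\tilde h_j}{\partial x_k},\qquad \tilde b_j(\xi,s)=-\frac{\partial\tilde h_j}{\partial s},\qquad \tilde c_j(\xi,s)=D\nabla^2\tilde h_j,$$ evaluated at the point $x$ with $\tilde h(x,s)=\xi$; they are $1$-periodic in $s$, and $(\tilde a_{ij})$ is assumed uniformly elliptic. The principal periodic eigenvalue $\mu(\omega)$ is the unique real number for which the stated periodic problem has a solution $\phi$ with $\phi>0$ in $\Omega_0$ (the solution is then unique up to scaling). It coincides with the principal periodic eigenvalue associated with the $\frac{2\pi}{\omega}$-periodic domain $\Omega(t)=\tilde\Omega\left(\frac{\omega t}{2\pi}\right)$. *)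

(* Defs.v *)
(* The reals are an arbitrary realType R, and R^N is the space of row vectors. *)
From HB Require Import structures.
From mathcomp Require Import all_boot all_order all_algebra.
From mathcomp Require Import all_classical all_reals all_analysis.

Set Implicit Arguments.
Unset Strict Implicit.
Unset Printing Implicit Defensive.

Import Order.TTheory GRing.Theory Num.Theory.
Import numFieldNormedType.Exports.

Local Open Scope classical_set_scope.
Local Open Scope ring_scope.

Section Defs.
Context {R : realType} {N : nat}.

Local Notation E := 'rV[R]_N.

Definition ebase (i : 'I_N) : E := delta_mx 0 i.

Definition pd (i : 'I_N) (f : E -> R) : E -> R := 'D_(ebase i) f.

(* [:: i1; ...; ik] stands for the iterated derivative d_i1 ... d_ik *)
Definition iter_pd (l : seq 'I_N) (f : E -> R) : E -> R := foldr pd f l.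

(* f is C^oo on the open set U: all iterated partial derivatives exist and are
   continuous at every point of U *)
Definition smooth_on (U : set E) (f : E -> R) : Prop :=
  forall (l : seq 'I_N) (x : E), U x ->
    {for x, continuous (iter_pd l f)} /\
    (forall i, derivable (iter_pd l f) x (ebase i)).

Definition bounded_domain (Om : set E) : Prop :=
  [/\ open Om, Om !=set0, connected Om & bounded_set Om].

(* Smoothness of the boundary through local defining functions: near each
   boundary point, Om is a strict sublevel set of a C^oo function whose gradient
   does not vanish at the point. *)
Definition smooth_bounded_domain (Om : set E) : Prop :=
  bounded_domain Om /\
  forall p, (closure Om `\` Om) p ->
    exists (U : set E) (rho : E -> R),
      [/\ open U, U p, smooth_on U rho,
          (exists i, pd i rho p != 0) &
          Om `&` U = [set x | U x /\ rho x < 0]].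

Definition has_cont_ext {T : topologicalType} (A : set T) (f : T -> R) : Prop :=
  exists g : T -> R,
    {within closure A, continuous g} /\ (forall x, A x -> f x = g x).

(* C^2 up to the boundary: the derivatives of order at most 2 exist in the open
   set Om and extend continuously to its closure *)
Definition C2_closure (Om : set E) (u : E -> R) : Prop :=
  [/\ {within closure Om, continuous u},
      (forall i x, Om x -> derivable u x (ebase i)),
      (forall i, has_cont_ext Om (pd i u)),
      (forall i j x, Om x -> derivable (pd j u) x (ebase i)) &
      (forall i j, has_cont_ext Om (pd i (pd j u)))].

(* C^{2,1} up to the lateral boundary of the cylinder Om x R: twice in the space
   variable and once in the time variable *)
Definition C21_closure (Om : set E) (phi : E -> R -> R) : Prop :=
  let Q : set (E * R) := Om `*` setT in
  [/\ {within closure Q, continuous (uncurry phi)},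
      (forall s x, Om x ->
         (forall i, derivable (phi^~ s) x (ebase i)) /\
         (forall i j, derivable (pd j (phi^~ s)) x (ebase i)) /\
         derivable (phi x) s 1),
      (forall i, has_cont_ext Q (fun p => pd i (phi^~ p.2) p.1)),
      (forall i j, has_cont_ext Q (fun p => pd i (pd j (phi^~ p.2)) p.1)) &
      has_cont_ext Q (fun p => derive1 (phi p.1) p.2)].

Definition holder_on (alpha : R) (A : set (E * R)) (f : E * R -> R) : Prop :=
  exists K : R, forall p q, A p -> A q -> `|f p - f q| <= K * `|p - q| `^ alpha.

(* C^{1+alpha,1+alpha} on closure Om x [0,1]: the first order derivatives, in
   space and in time, exist and are alpha-Holder on the open cylinder; they then
   extend to alpha-Holder functions on the closed one. *)
Definition C1holder (alpha : R) (Om : set E) (f : E -> R -> R) : Prop :=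
  let Q : set (E * R) := Om `*` [set` `]0, 1[ ] in
  [/\ {within closure Om `*` [set` `[0, 1]], continuous (uncurry f)},
      (forall x s, Q (x, s) ->
         (forall i, derivable (f^~ s) x (ebase i)) /\ derivable (f x) s 1),
      (forall i, holder_on alpha Q (fun p => pd i (f^~ p.2) p.1)) &
      holder_on alpha Q (fun p => derive1 (f p.1) p.2)].

(* The third condition says that x stays in the domain for nearby times, so that
   the time derivative of the transformation at (x, s) is meaningful. *)
Definition periodic_domains (Omt : R -> set E) : Prop :=
  [/\ (forall s, bounded_domain (Omt s)),
      (forall s, Omt (s + 1) = Omt s) &
      (forall s x, Omt s x -> \forall t \near s, Omt t x)].

Definition hcomp (h : E -> R -> E) (j : 'I_N) (s : R) : E -> R :=
  fun x => h x s ord0 j.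

Definition domain_maps (Omt : R -> set E) (Om0 : set E) (h : E -> R -> E) : Prop :=
  [/\ (forall s, set_bij (closure (Omt s)) (closure Om0) (h^~ s)),
      (forall s, set_bij (Omt s) Om0 (h^~ s)),
      (forall s x, closure (Omt s) x -> h x (s + 1) = h x s) &
      (forall s x, Omt s x -> forall j,
         [/\ (forall k, derivable (hcomp h j s) x (ebase k)),
             (forall k, derivable (pd k (hcomp h j s)) x (ebase k)) &
             derivable (fun t => hcomp h j t x) s 1])].

(* The coefficients are evaluated at xi = h x s; on the boundary of the
   reference domain their values are determined by continuity. *)
Definition transformed_coefficients (D : R) (Omt : R -> set E) (h : E -> R -> E)
    (a : 'I_N -> 'I_N -> E -> R -> R) (b c : 'I_N -> E -> R -> R) : Prop :=
  forall s x, Omt s x ->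
    [/\ (forall i j, a i j (h x s) s =
           \sum_k D * pd k (hcomp h i s) x * pd k (hcomp h j s) x),
        (forall j, b j (h x s) s = - derive1 (fun t => hcomp h j t x) s) &
        (forall j, c j (h x s) s = D * \sum_k pd k (pd k (hcomp h j s)) x)].

Definition uniformly_elliptic (Om : set E) (a : 'I_N -> 'I_N -> E -> R -> R) : Prop :=
  exists theta : R, 0 < theta /\
    forall (xi : E) (s : R) (eta : 'I_N -> R), closure Om xi -> 0 <= s <= 1 ->
      theta * (\sum_i eta i ^+ 2) <= \sum_i \sum_j a i j xi s * eta i * eta j.

Definition Lop (a : 'I_N -> 'I_N -> E -> R -> R) (b c : 'I_N -> E -> R -> R)
    (omega s : R) (u : E -> R) (xi : E) : R :=
  \sum_i \sum_j a i j xi s * pd i (pd j u) xi +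
  \sum_j (omega / (2 * pi) * b j xi s + c j xi s) * pd j u xi.

(* lam is the principal eigenvalue of - L on Om with zero Dirichlet condition:
   the number for which there is an eigenfunction positive in Om. *)
Definition principal_eigenvalue (Om : set E) (L : (E -> R) -> E -> R) (lam : R) : Prop :=
  exists u : E -> R,
    [/\ C2_closure Om u,
        (forall xi, Om xi -> 0 < u xi),
        (forall xi, (closure Om `\` Om) xi -> u xi = 0) &
        (forall xi, Om xi -> - L u xi = lam * u xi)].

Definition principal_periodic_eigenvalue (Om : set E)
    (L : R -> (E -> R) -> E -> R) (omega m : R) : Prop :=
  exists phi : E -> R -> R,
    [/\ C21_closure Om phi,
        (forall xi s, Om xi -> 0 < phi xi s),
        (forall xi s, (closure Om `\` Om) xi -> 0 <= s <= 1 -> phi xi s = 0),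
        (forall xi s, Om xi -> phi xi s = phi xi (s + 1)) &
        (forall xi s, Om xi -> 0 <= s <= 1 ->
           omega / (2 * pi) * derive1 (phi xi) s - L s (phi^~ s) xi = m * phi xi s)].

End Defs.

(* Main.v *)
Require Import Defs.
From mathcomp Require Import all_boot all_order all_algebra.
From mathcomp Require Import all_classical all_reals all_analysis.
From mathcomp Require Import lra ring.
Import Order.TTheory GRing.Theory Num.Theory.
Import numFieldNormedType.Exports.
Local Open Scope classical_set_scope.
Local Open Scope ring_scope.

(** In the rescaled time s the equation is parabolic with the slow clock
    kappa = omega / (2 pi): over a short interval of s around s0, the positive
    periodic solution phi has a time of order 1 / omega to follow the operator
    frozen at s0, with principal eigenvalue lambda(s0). A profile psi close to
    the principal eigenfunction at s0 is an approximate subsolution, so the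
    parabolic maximum principle carries an inequality m psi <= phi from the
    beginning of the interval to its end, where m may be multiplied by
    exp((mu - lambda(s0) - eps) ds / kappa) (profile_comparison). Passing to the
    profile of the next interval costs a constant that does not depend on omega,
    and finitely many intervals cover the period (interval_chaining). Since phi is
    periodic, the total factor cannot exceed 1 (period_growth_le0): its logarithm
    times kappa gives mu <= (integral of lambda) + eps + O(omega). Supersolutions
    give the reverse inequality in the same way; a sign sigma treats both cases at
    once. The profiles may jump from one interval to the next, so that a fixed
    eigenfunction serves for a whole interval.

    The delicate point is the boundary, where every function involved vanishes:
    profiles must be comparable up to the boundary, and errors that are small in
    the supremum norm are not small compared with the eigenfunction. Both are
    handled with one auxiliary function z, the eigenfunction at s = 0 and
    omega = 0. Hopf's lemma (hopf_gradient) shows that its gradient does not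
    vanish on the boundary. Hence, in a boundary layer, the operators take
    z + sigma K z^2 to values of sign sigma and of any prescribed size, uniformly
    in s and omega (bend_barrier). Three consequences follow by the maximum
    principle: twice differentiable functions that vanish on the boundary are at
    most a multiple of z (boundary_upper_bound); positive periodic solutions are
    at least a multiple of z (boundary_lower_bound); and adding a small multiple
    of z + sigma K z^2 to an eigenfunction absorbs the error made when the
    operator is slightly changed (perturbed_profile).

    The continuity of lambda, hence its integrability, comes from the same
    comparison: an eigenfunction is a stationary solution of the problem frozen in
    time, and can be compared with the profile built at a nearby time
    (eigenvalue_one_sided). *)

Set Implicit Arguments.
Unset Strict Implicit.
Unset Printing Implicit Defensive.

(** * Directional derivatives from continuous partial derivatives *)

Section Calculus.
Context {R : realType} {N : nat}.
Local Notation E := 'rV[R]_N.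
Implicit Types (f g : E -> R) (x v w : E).

(** Moves a directional derivative to a derivative in one real variable, where
    the mean value theorem is available. *)
Lemma is_derive_line f x v (t d : R) :
  is_derive (x + t *: v) v f d <-> is_derive t 1 (fun s => f (x + s *: v)) d.
Proof.
set F := fun s => f (x + s *: v).
have E : (fun h : R => h^-1 *: ((F \o shift t) (h *: (1:R)) - F t)) =
  (fun h => h^-1 *: ((f \o shift (x + t *: v)) (h *: v) - f (x + t *: v))).
  apply/funext => h; rewrite /F /=; congr (_ *: (f _ - _)).
  by rewrite [h *: 1]mulr1 scalerDl addrCA.
by split; case=> df dE; apply: DeriveDef;
  rewrite /derivable /derive ?E // -E.
Qed.

Lemma is_derive_scale f x v (k d : R) :
  is_derive x v f d -> is_derive x (k *: v) f (k * d).
Proof.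
move=> dfx; rewrite -[x]addr0 -(scale0r (k *: v)); apply/is_derive_line.
under [X in is_derive _ _ X _]funext => s do rewrite scalerA.
rewrite [k * d]mulrC.
apply: (@is_derive1_comp R (fun s => f (x + s *: v)) (fun s => s * k) 0 d k).
  by rewrite mul0r; apply/is_derive_line; rewrite scale0r addr0.
by apply: is_derive_eq; rewrite /= scaler0 add0r [LHS]mulr1.
Qed.

(** The increment t may have either sign, as in a two-sided derivative. *)
Lemma MVT_symmetric (F dF : R -> R) (t : R) :
  (forall s : R, `|s| <= `|t| -> is_derive s (1 : R) F (dF s)) ->
  exists2 c, `|c| <= `|t| & F t - F 0 = dF c * t.
Proof.
move=> dFP.
have cF (s : R) : `|s| <= `|t| -> {for s, continuous F}.
  move=> /dFP [d _]; apply: differentiable_continuous.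
  exact/derivable1_diffP.
have cw (a b : R) : (forall s, s \in `[a, b] -> `|s| <= `|t|) ->
    {within `[a, b], continuous F}.
  move=> ab; apply: continuous_in_subspaceT => s /[!inE] /ab; exact: cF.
have [t0|t0] := leP 0 t.
  have sub (s : R) : s \in `[0, t] -> `|s| <= `|t|.
    by rewrite in_itv/= => /andP[s0 st]; rewrite !ger0_norm.
  have [||c ct ->] := @MVT_segment R F dF 0 t t0; last 1 first.
  - by exists c; [exact: sub|rewrite subr0].
  - by move=> s st; apply/dFP/sub; exact: subset_itv_oo_cc.
  - exact: cw.
have sub (s : R) : s \in `[t, 0] -> `|s| <= `|t|.
  by rewrite in_itv/= => /andP[s0 st]; rewrite !ler0_norm ?lerN2// ltW.
have [||c ct H] := @MVT_segment R F dF t 0 (ltW t0).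
- by move=> s st; apply/dFP/sub; exact: subset_itv_oo_cc.
- exact: cw.
by exists c; [exact: sub|rewrite -opprB H sub0r mulrN opprK].
Qed.

(** The increment along v + w splits at x + t v. The first part has quotient dv
    in the limit; the mean value theorem turns the second into a value of Dw
    near x, and Dw is continuous at x. Adding one coordinate direction at a time
    yields the chain rule from continuous partial derivatives. *)
Lemma is_derive_add_direction (U : set E) f x v w dv (Dw : E -> R) : open U -> U x ->
  (forall y, U y -> is_derive y w f (Dw y)) -> {for x, continuous Dw} ->
  is_derive x v f dv -> is_derive x (v + w) f (dv + Dw x).
Proof.
move=> oU Ux dw cw [] {}dv <-.
pose q t := t^-1 *: (f (t *: (v + w) + x) - f x).
suff H : q @ 0^' --> 'D_v f x + Dw x.
  have Hd : derivable f x (v + w) by apply/cvg_ex; eexists; exact: H.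
  by apply: DeriveDef => //; apply/cvg_lim.
pose q1 t := t^-1 *: (f (t *: v + x) - f x).
pose q2 t := t^-1 *: (f (t *: (v + w) + x) - f (t *: v + x)).
have -> : q = (fun t => q1 t + q2 t).
  by apply/funext => t; rewrite /q /q1 /q2 -scalerDr; congr (_ *: _); ring.
apply: cvgD; first exact: dv.
apply/cvgrPdist_le => e e0.
have cw' : Dw @ x --> Dw x := cw.
have DD : \forall y \near x, `|Dw x - Dw y| <= e.
  by move/cvgrPdist_le : cw'; apply.
have UU : nbhs x U by exact: open_nbhs_nbhs.
have /nbhs_ballP[r /= r0 rP] :
  nbhs x (U `&` [set y | `|Dw x - Dw y| <= e]) by exact: filterI.
pose B := `|v| + `|w| + 1.
have B0 : 0 < B by rewrite ltr_wpDl// addr_ge0.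
exists (r / B) => /=; first by rewrite divr_gt0.
move=> t /=; rewrite sub0r normrN => tr tn0.
have near (s : R) : `|s| <= `|t| -> ball x r (t *: v + x + s *: w).
  move=> st; rewrite -ball_normE /= opprD opprD addrA addrA (addrC x) addrK.
  rewrite -opprD normrN; apply: le_lt_trans (ler_normD _ _) _; rewrite !normrZ.
  have tB : `|t| * B < r by rewrite -ltr_pdivlMr.
  apply: le_lt_trans _ tB; rewrite /B !mulrDr mulr1 -addrA lerD2l.
  by rewrite ler_wpDr// ler_wpM2r.
have [|c ct] := @MVT_symmetric (fun s => f (t *: v + x + s *: w))
    (fun s => Dw (t *: v + x + s *: w)) t.
  move=> s st; apply/is_derive_line; apply/dw.
  by have [] := rP _ (near _ st).
rewrite scale0r addr0 => H.
have -> : q2 t = Dw (t *: v + x + c *: w).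
  have -> : q2 t = t^-1 *: (f (t *: v + x + t *: w) - f (t *: v + x)).
    by rewrite /q2 (scalerDr t) addrAC.
  rewrite H.
  by rewrite [LHS]mulrC mulfK.
by have [] := rP _ (near _ ct).
Qed.

Definition C1on (U : set E) f := forall x, U x -> forall i : 'I_N,
  derivable f x (ebase i) /\ {for x, continuous (pd i f)}.

Lemma C1on_directional_derivative U f x v : open U -> C1on U f -> U x ->
  is_derive x v f (\sum_i v ord0 i * pd i f x).
Proof.
move=> oU cf; rewrite [v in is_derive _ v]row_sum_delta.
elim: (index_enum _) x => [|i r IH] x Ux.
  by rewrite !big_nil; exact: is_derive0.
rewrite !big_cons [_ *: _ + _]addrC [_ * _ + _]addrC.
have dl z : U z -> is_derive z (v ord0 i *: ebase i) f (v ord0 i * pd i f z).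
  by move=> Uz; apply/is_derive_scale/derivableP; have [] := cf z Uz i.
apply: (is_derive_add_direction oU Ux dl); last exact: IH.
apply: (@continuousM _ _ (cst (v ord0 i)) (pd i f)); last by have [] := cf x Ux i.
exact: cst_continuous.
Qed.
End Calculus.

(** * Twice continuously differentiable functions and elliptic operators *)

Section C2.
Context {R : realType} {N : nat}.
Local Notation E := 'rV[R]_N.
Implicit Types (f g : E -> R) (x v w : E) (U : set E).

Lemma open_continuous_eq U f g x : open U -> U x -> (forall y, U y -> f y = g y) ->
  {for x, continuous f} -> {for x, continuous g}.
Proof.
move=> oU Ux fg cf; have cf' : f @ x --> f x := cf.
suff : g @ x --> g x by [].
rewrite -(fg _ Ux).
have fgx : {near x, f =1 g}.
  near=> y; rewrite fg//; near: y; exact: open_nbhs_nbhs.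
exact: cvg_trans (near_eq_cvg fgx) cf'.
Unshelve. all: by end_near. Qed.

Lemma open_is_derive_eq U f g x v d : open U -> U x -> (forall y, U y -> f y = g y) ->
  is_derive x v f d -> is_derive x v g d.
Proof.
move=> oU Ux fg; apply: near_eq_is_derive.
near=> y; rewrite fg//; near: y; exact: open_nbhs_nbhs.
Unshelve. all: by end_near. Qed.

(** Partial derivatives computed pointwise on an open set identify the partial
    derivative functions near each point, hence transfer their continuity. *)
Lemma C1onP U f (df : 'I_N -> E -> R) : open U ->
  (forall i x, U x -> is_derive x (ebase i) f (df i x) /\
     {for x, continuous (df i)}) ->
  C1on U f /\ forall i x, U x -> pd i f x = df i x.
Proof.
move=> oU H.
have E i x : U x -> pd i f x = df i x by move=> Ux; have [[_ <-] _] := H i x Ux.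
split; last exact: E.
move=> x Ux i; have [[d _] c] := H i x Ux; split; first exact: d.
by refine (open_continuous_eq oU Ux _ c) => y Uy; rewrite E.
Qed.

Lemma C1on_eq U f g : open U -> (forall x, U x -> f x = g x) -> C1on U f ->
  C1on U g /\ forall i x, U x -> pd i g x = pd i f x.
Proof.
move=> oU fg cf; apply: (C1onP oU) => i x Ux; have [d c] := cf x Ux i.
split; last exact: c.
exact: (open_is_derive_eq oU Ux fg (derivableP d)).
Qed.

Lemma continuous_lin f g (a b : R) x : {for x, continuous f} ->
  {for x, continuous g} -> {for x, continuous (fun x => a * f x + b * g x)}.
Proof.
move=> cf cg; have cstc c : {for x, continuous (fun _ : E => c : R)}.
  exact: cst_continuous.
exact: (continuousD (continuousM (cstc a) cf) (continuousM (cstc b) cg)).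
Qed.

Lemma C1on_lin U f g (a b : R) : open U -> C1on U f -> C1on U g ->
  C1on U (fun x => a * f x + b * g x) /\
  forall i x, U x -> pd i (fun x => a * f x + b * g x) x = a * pd i f x + b * pd i g x.
Proof.
move=> oU cf cg; apply: C1onP => // i x Ux.
have [df ccf] := cf x Ux i; have [dg ccg] := cg x Ux i.
split; last exact: continuous_lin.
exact: (is_deriveD (is_deriveZ a (derivableP df)) (is_deriveZ b (derivableP dg))).
Qed.

Lemma C1on_mul U f g : open U -> (forall x, U x -> {for x, continuous f}) ->
  (forall x, U x -> {for x, continuous g}) -> C1on U f -> C1on U g ->
  C1on U (fun x => f x * g x) /\
  forall i x, U x -> pd i (fun x => f x * g x) x = f x * pd i g x + g x * pd i f x.
Proof.
move=> oU cf0 cg0 cf cg; apply: C1onP => // i x Ux.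
have [df ccf] := cf x Ux i; have [dg ccg] := cg x Ux i.
split; last first.
  exact: (continuousD (continuousM (cf0 x Ux) ccg) (continuousM (cg0 x Ux) ccf)).
exact: (is_deriveM (derivableP df) (derivableP dg)).
Qed.

(** Every iterated derivative is required to be continuous on all of U, which
    is what the chain rule along lines needs at orders one and two. *)
Definition C2on U f := [/\ (forall x, U x -> {for x, continuous f}), C1on U f &
  forall j, C1on U (pd j f)].

Lemma C2on_lin U f g (a b : R) : open U -> C2on U f -> C2on U g ->
  [/\ C2on U (fun x => a * f x + b * g x),
   (forall i x, U x ->
     pd i (fun x => a * f x + b * g x) x = a * pd i f x + b * pd i g x) &
   forall i j x, U x -> pd i (pd j (fun x => a * f x + b * g x)) x =
     a * pd i (pd j f) x + b * pd i (pd j g) x].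
Proof.
move=> oU [f0 f1 f2] [g0 g1 g2]; have [l1 l1E] := C1on_lin a b oU f1 g1.
have H j : C1on U (pd j (fun x => a * f x + b * g x)) /\
    forall i x, U x -> pd i (pd j (fun x => a * f x + b * g x)) x =
     a * pd i (pd j f) x + b * pd i (pd j g) x.
  have [l2 l2E] := C1on_lin a b oU (f2 j) (g2 j).
  have [c cE] := C1on_eq oU (fun x Ux => esym (l1E j x Ux)) l2.
  split; first exact: c.
  by move=> i x Ux; rewrite (cE _ _ Ux) (l2E _ _ Ux).
split; [|exact: l1E|by move=> i j x Ux; exact: (H j).2].
split; [|exact: l1|by move=> j; exact: (H j).1].
by move=> x Ux; apply: (@continuous_lin f g a b x); [exact: f0|exact: g0].
Qed.

Lemma C2on_sqr U f : open U -> C2on U f ->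
  [/\ C2on U (fun x => f x ^+ 2),
   (forall i x, U x -> pd i (fun x => f x ^+ 2) x = 2 * f x * pd i f x) &
   forall i j x, U x -> pd i (pd j (fun x => f x ^+ 2)) x =
     2 * (pd i f x * pd j f x + f x * pd i (pd j f) x)].
Proof.
move=> oU [f0 f1 f2].
have [m1 m1E] := C1on_mul oU f0 f0 f1 f1.
have E1 j x : U x -> pd j (fun x => f x ^+ 2) x = 2 * (f x * pd j f x) + 0 * f x.
  move=> Ux; rewrite -[LHS]/(pd j (fun x => f x * f x) x) (m1E _ _ Ux).
    by move: (pd j f x) (f x) => a b; ring.
have H j : C1on U (pd j (fun x => f x ^+ 2)) /\
    forall i x, U x -> pd i (pd j (fun x => f x ^+ 2)) x =
     2 * (pd i f x * pd j f x + f x * pd i (pd j f) x).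
  have c1 x : U x -> {for x, continuous (pd j f)} by move=> /f1 /(_ j) [].
  have [p1 p1E] := C1on_mul oU f0 c1 f1 (f2 j).
  have [l2 l2E] := C1on_lin 2 0 oU p1 f1.
  have [c cE] := C1on_eq oU (fun x Ux => esym (E1 j x Ux)) l2.
  split; first exact: c.
  move=> i x Ux; rewrite (cE _ _ Ux) (l2E _ _ Ux) (p1E _ _ Ux).
  by move: (pd j f x) (f x) (pd i f x) (pd i (pd j f) x) => a1 a2 a3 a4; ring.
split; [|by move=> i x Ux; rewrite (E1 _ _ Ux) mul0r addr0 mulrA
  |by move=> i j x Ux; exact: (H j).2].
split; [|exact: m1|by move=> j; exact: (H j).1].
by move=> x Ux; apply: (@continuousM _ _ f f x); exact: f0.
Qed.

(** If H were negative, G would be negative just to the right of 0, and F would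
    drop below its minimum by the mean value theorem. *)
Lemma second_derivative_test (F G : R -> R) (r H : R) : 0 < r ->
  (forall t : R, `|t| < r -> is_derive t (1 : R) F (G t)) ->
  is_derive (0 : R) (1 : R) G H ->
  (forall t : R, `|t| < r -> F 0 <= F t) -> G 0 = 0 /\ 0 <= H.
Proof.
move=> r0 FG [GH dGH] Fmin.
have itvr t : t \in `](- r), r[ -> `|t| < r.
  by rewrite in_itv/= ltr_norml.
have r00 : (0 : R) \in `](- r), r[ by rewrite in_itv/= oppr_lt0 r0.
have [_ D0] : is_derive (0 : R) (1 : R) F 0.
  apply: (@derive1_at_min _ F (- r) r 0 _ _ r00).
  - by rewrite ltW// gtrN.
  - by move=> t /itvr /FG [].
  - by move=> t /itvr /Fmin.
have G0 : G 0 = 0 by have := FG 0; rewrite normr0 => /(_ r0) [_ <-].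
split; first exact: G0.
rewrite leNgt; apply/negP => H0.
have := GH; rewrite /derivable => cH.
have {cH} : (fun h : R => h^-1 *: ((G \o shift 0) (h *: (1 : R)) - G 0)) @ 0^' --> H.
  by rewrite -dGH; exact: cH.
move=> /cvgr_lt /(_ _ H0) [e /= e0 eP].
pose t := Num.min (e / 2) (r / 2).
have t0 : 0 < t by rewrite lt_min !divr_gt0.
have te : t < e by rewrite gt_min ltr_pdivrMr// ltr_pMr// ltr1n.
have tr : t < r by rewrite gt_min orbC ltr_pdivrMr// ltr_pMr// ltr1n.
have Gneg c : 0 < c -> c <= t -> G c < 0.
  move=> c0 ct; have := eP c; rewrite /= sub0r normrN gtr0_norm// (le_lt_trans ct te).
  move=> /(_ isT (lt0r_neq0 c0)).
  by rewrite G0 subr0 addr0 [c *: 1]mulr1 [_ *: _]mulrC pmulr_llt0// invr_gt0.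
have nr c : 0 <= c -> c <= t -> `|c| < r.
  by move=> c0 ct; rewrite ger0_norm// (le_lt_trans ct).
have [||c] := @MVT R F G 0 t t0.
- by move=> s /[!in_itv]/= /andP[s0 st]; apply/FG/nr; exact: ltW.
- apply: continuous_in_subspaceT => s /[!inE]/= /[!in_itv]/= /andP[s0 st].
  by apply/differentiable_continuous/derivable1_diffP; have [] := FG s (nr _ s0 st).
rewrite in_itv/= => /andP[c0 ct]; rewrite subr0 => Ft.
have := Fmin t (nr _ (ltW t0) (lexx _)); rewrite leNgt => /negP; apply.
by rewrite -subr_lt0 Ft nmulr_rlt0 ?Gneg// ltW.
Qed.

(** The value of a second order operator at a point depends only on its
    coefficients there, so that variable coefficients are functions into this type. *)
Definition coef := (('I_N -> 'I_N -> R) * ('I_N -> R))%type.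

Definition ellop (c : coef) f x : R :=
  \sum_i \sum_j c.1 i j * pd i (pd j f) x + \sum_j c.2 j * pd j f x.

Lemma ellop_lin U f g (a b : R) (c : coef) x : open U -> C2on U f -> C2on U g -> U x ->
  ellop c (fun x => a * f x + b * g x) x = a * ellop c f x + b * ellop c g x.
Proof.
move=> oU cf cg Ux; have [_ E1 E2] := C2on_lin a b oU cf cg.
rewrite /ellop !mulrDr addrACA; congr (_ + _).
  rewrite !mulr_sumr -big_split/=; apply: eq_bigr => i _.
  rewrite !mulr_sumr -big_split/=; apply: eq_bigr => j _.
  rewrite (E2 _ _ _ Ux).
  by move: (pd i (pd j f) x) (pd i (pd j g) x) (c.1 i j) => a1 a2 a3; ring.
rewrite !mulr_sumr -big_split/=; apply: eq_bigr => i _; rewrite (E1 _ _ Ux).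
by move: (pd i f x) (pd i g x) (c.2 i) => a1 a2 a3; ring.
Qed.

Lemma ellop_sqr U f (c : coef) x : open U -> C2on U f -> U x ->
  ellop c (fun x => f x ^+ 2) x =
  2 * f x * ellop c f x + 2 * \sum_i \sum_j c.1 i j * (pd i f x * pd j f x).
Proof.
move=> oU cf Ux; have [_ E1 E2] := C2on_sqr oU cf.
rewrite /ellop mulrDr addrAC; congr (_ + _).
  rewrite !mulr_sumr -big_split/=; apply: eq_bigr => i _.
  rewrite !mulr_sumr -big_split/=; apply: eq_bigr => j _.
  rewrite (E2 _ _ _ Ux).
  by move: (f x) (pd i (pd j f) x) (pd i f x) (pd j f x) (c.1 i j)
    => a1 a2 a3 a4 a5; ring.
rewrite mulr_sumr; apply: eq_bigr => i _; rewrite (E1 _ _ Ux).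
by move: (f x) (pd i f x) (c.2 i) => a1 a2 a3; ring.
Qed.

Lemma ellop_bound (c : coef) f x (t M : R) : 0 <= t ->
  (forall i j, `|c.1 i j| <= t) -> (forall j, `|c.2 j| <= t) ->
  (forall i, `|pd i f x| <= M) -> (forall i j, `|pd i (pd j f) x| <= M) ->
  `|ellop c f x| <= t * (M * (N * N + N)%:R).
Proof.
move=> t0 c1 c2 f1 f2; rewrite natrD !mulrDr; apply: le_trans (ler_normD _ _) _.
apply: lerD; apply: le_trans (ler_norm_sum _ _ _) _.
  apply: (@le_trans _ _ (\sum_(i < N) \sum_(j < N) t * M)).
    apply: ler_sum => i _; apply: le_trans (ler_norm_sum _ _ _) _.
    by apply: ler_sum => j _; rewrite normrM ler_pM.
  by rewrite sumr_const sumr_const card_ord -mulrnA -(mulr_natr (t * M)) mulrA.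
apply: (@le_trans _ _ (\sum_(i < N) t * M)).
  by apply: ler_sum => j _; rewrite normrM ler_pM.
by rewrite sumr_const card_ord -(mulr_natr (t * M)) mulrA.
Qed.

(** The form in which the transformed coefficients are positive semidefinite:
    a multiple of J J^T. It turns the contraction with a Hessian into a sum of
    second directional derivatives along the columns of J. *)
Definition gram (A : 'I_N -> 'I_N -> R) := exists2 D : R, 0 <= D &
  exists J : 'I_N -> 'I_N -> R, forall i j, A i j = D * \sum_k J i k * J j k.

(** At a minimum the gradient vanishes and every second directional derivative
    is nonnegative; the second order part is a nonnegative combination of such
    derivatives. *)
Lemma ellop_min U f (c : coef) x : open U -> C2on U f -> U x -> gram c.1 ->
  (\forall y \near x, f x <= f y) -> 0 <= ellop c f x.
Proof.
move=> oU [f0 f1 f2] Ux [D D0 [J JE]] xmin.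
pose dd v y := \sum_i v ord0 i * pd i f y.
have test v : dd v x = 0 /\ 0 <= \sum_i \sum_j v ord0 i * v ord0 j * pd i (pd j f) x.
  have /nbhs_ballP[e /= e0 eP] :
      nbhs x (U `&` [set y | f x <= f y]).
    by apply: filterI; [exact: open_nbhs_nbhs|exact: xmin].
  pose B := `|v| + 1; have B0 : 0 < B by rewrite ltr_wpDl.
  have near (t : R) : `|t| < e / B -> ball x e (x + t *: v).
    rewrite -ball_normE/= opprD addrA subrr sub0r normrN normrZ => te.
    apply: le_lt_trans (_ : `|t| * B < e); last by rewrite -ltr_pdivlMr.
    by rewrite ler_wpM2l// lerDl.
  have := @second_derivative_test (fun t => f (x + t *: v))
    (fun t => dd v (x + t *: v)) (e / B)
    (\sum_i \sum_j v ord0 i * v ord0 j * pd i (pd j f) x).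
  rewrite scale0r addr0; apply.
  - by rewrite divr_gt0.
  - move=> t te; apply/is_derive_line; apply: C1on_directional_derivative oU f1 _.
    by have [] := eP _ (near t te).
  - apply/is_derive_line; rewrite scale0r addr0.
    have Hd : is_derive x v (dd v)
        (\sum_j v ord0 j *: \sum_i v ord0 i * pd i (pd j f) x).
      have -> : dd v = \sum_(i < N) (v ord0 i *: (pd i f : E -> R)).
        by apply/funext => y; rewrite fct_sumE; apply: eq_bigr => i _.
      apply: is_derive_sum => j; apply: is_deriveZ.
      exact: C1on_directional_derivative oU (f2 j) _.
    apply: (is_derive_eq Hd).
    rewrite exchange_big/=; apply: eq_bigr => j _; rewrite scaler_sumr.
    by apply: eq_bigr => i _; rewrite [_ *: _]mulrA (mulrC (v ord0 j)).
  - by move=> t te; have [] := eP _ (near t te).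
have pd0 i : pd i f x = 0.
  have [+ _] := test (ebase i); rewrite /dd (bigD1 i)//= big1 ?addr0.
    by rewrite /ebase mxE !eqxx mul1r.
  by move=> j ji; rewrite /ebase mxE eqxx (negbTE ji) mul0r.
rewrite /ellop [X in _ + X]big1 ?addr0; last by move=> j _; rewrite pd0 mulr0.
have -> : \sum_i \sum_j c.1 i j * pd i (pd j f) x =
    D * \sum_k \sum_i \sum_j J i k * J j k * pd i (pd j f) x.
  rewrite [X in D * X]exchange_big mulr_sumr; apply: eq_bigr => i _.
  rewrite [X in D * X]exchange_big mulr_sumr; apply: eq_bigr => j _.
  rewrite JE -mulrA; congr (_ * _).
  by rewrite mulr_suml.
apply: (mulr_ge0 D0); apply: sumr_ge0 => k _.
have [_] := test (\row_i J i k).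
by under eq_bigr do under eq_bigr do rewrite !mxE.
Qed.

End C2.

(** * Continuity on subsets and compactness *)

Lemma within_comp_continuous (T U V : topologicalType) (A : set T) (B : set U)
    (f : T -> U) (g : U -> V) : {within A, continuous f} ->
  (forall x, A x -> B (f x)) -> {within B, continuous g} ->
  {within A, continuous (g \o f)}.
Proof.
move=> /subspace_continuousP cf AB /subspace_continuousP cg.
apply/subspace_continuousP => x Ax W /(cg _ (AB x Ax)) BW.
have := cf _ Ax _ BW; rewrite /= /nbhs/= /within/=.
by apply: filterS => y H Ay; exact: (H Ay (AB y Ay)).
Qed.

Lemma within_continuous_at (T U : topologicalType) (A : set T) (f : T -> U) x :
  {within A, continuous f} -> A° x -> {for x, continuous f}.
Proof.
move=> /subspace_continuousP cf Ax; have := cf x (interior_subset Ax).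
by rewrite within_interior.
Qed.

Lemma continuous_at_within (T U : topologicalType) (K : set T) (f : T -> U) :
  (forall x, K x -> {for x, continuous f}) -> {within K, continuous f}.
Proof. by move=> cf; apply: continuous_in_subspaceT => x /[!inE]; exact: cf. Qed.

Section Topology.
Context {R : realType}.

Lemma within_continuous_norm (T : topologicalType) (K : set T) (f : T -> R) :
  {within K, continuous f} -> {within K, continuous (fun x => `|f x|)}.
Proof.
move=> cf; apply: (@within_comp_continuous _ _ _ K setT f (fun y => `|y|)) => //.
by apply: continuous_subspaceT => y; exact: norm_continuous.
Qed.

(** Stated for a possibly empty K, where any positive constant works. *)
Lemma compact_pos_min (T : topologicalType) (K : set T) (f : T -> R) : compact K ->
  {within K, continuous f} -> (forall x, K x -> 0 < f x) ->
  exists2 c : R, 0 < c & forall x, K x -> c <= f x.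
Proof.
move=> cK cf f0; have [K0|K0] := pselect (K !=set0); last first.
  by exists 1 => // x Kx; case: K0; exists x.
have [m Km mP] := compact_EVT_min K0 cK cf.
exists (f m); first by apply/f0/set_mem.
by move=> x Kx; apply/mP/mem_set.
Qed.

Lemma compact_abs_bound (T : topologicalType) (K : set T) (f : T -> R) : compact K ->
  {within K, continuous f} -> exists2 M : R, 0 <= M & forall x, K x -> `|f x| <= M.
Proof.
move=> cK cf; have [K0|K0] := pselect (K !=set0); last first.
  by exists 1 => // x Kx; case: K0; exists x.
have cnf := within_continuous_norm cf.
have [m Km mP] := compact_EVT_max K0 cK cnf.
by exists `|f m| => // x Kx; apply/mP/mem_set.
Qed.

Lemma within_continuous_lin (T : topologicalType) (K : set T) (f g : T -> R) (a b : R) :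
  {within K, continuous f} -> {within K, continuous g} ->
  {within K, continuous (fun x => a * f x + b * g x)}.
Proof.
move=> cf cg x.
have cstc (k : R) : {for x, continuous ((fun _ => k) : subspace K -> R)}.
  exact: cst_continuous.
exact: (continuousD (continuousM (cstc a) (cf x)) (continuousM (cstc b) (cg x))).
Qed.

Lemma within_continuous_sqr (T : topologicalType) (K : set T) (f : T -> R) :
  {within K, continuous f} -> {within K, continuous (fun x => f x ^+ 2)}.
Proof. by move=> cf x; exact: (continuousM (cf x) (cf x)). Qed.

End Topology.

Section Closure.
Context {R : realType} {N : nat}.
Local Notation E := 'rV[R]_N.
Implicit Types (f g u : E -> R) (x v w p : E) (Om U : set E).

Lemma domain_closure_compact Om : bounded_domain Om -> compact (closure Om).
Proof.
move=> [_ _ _ [M [Mr MP]]]; apply: bounded_closed_compact; last exact: closed_closure.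
exists M; split=> // k Mk x clx.
have cl : closed [set x : E | `|x| <= k].
  apply: (preimage_closed (f := fun x : E => `|x|) (D := [set y : R | y <= k])).
    by move=> y _; exact: norm_continuous.
  exact: closed_le.
have sub : Om `<=` [set x : E | `|x| <= k] by move=> y /(MP k Mk).
by have := closureS sub clx; rewrite -(closure_id _).1.
Qed.

End Closure.

(** * The squared distance, and continuity of the operator *)

Section Distance.
Context {R : realType} {N : nat}.
Local Notation E := 'rV[R]_N.
Implicit Types (f g u : E -> R) (x v w p : E) (Om U : set E).

Lemma C2on_eq U f g : open U -> (forall x, U x -> f x = g x) -> C2on U f -> C2on U g.
Proof.
move=> oU fg [f0 f1 f2]; have [g1 g1E] := C1on_eq oU fg f1; split.
- by move=> x Ux; refine (open_continuous_eq oU Ux fg (f0 x Ux)).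
- exact: g1.
- move=> j; have [+ _] := C1on_eq oU (fun x Ux => esym (g1E j x Ux)) (f2 j).
  exact.
Qed.

Lemma C2on_subset U V f : U `<=` V -> C2on V f -> C2on U f.
Proof.
move=> UV [f0 f1 f2]; split.
- by move=> x /UV; exact: f0.
- by move=> x /UV; exact: f1.
- by move=> j x /UV; exact: f2.
Qed.

Lemma C1on_cst U (c : R) : C1on U (fun _ : E => c).
Proof.
move=> x _ i; split; first exact: derivable_cst.
have -> : pd i (fun _ : E => c) = fun _ => 0 by apply/funext => y; exact: derive_cst.
exact: cst_continuous.
Qed.

Lemma C2on_cst U (c : R) : C2on U (fun _ : E => c).
Proof.
split; [by move=> x _; exact: cst_continuous|exact: C1on_cst|move=> j].
have -> : pd j (fun _ : E => c) = fun _ => 0 by apply/funext => y; exact: derive_cst.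
exact: C1on_cst.
Qed.

Lemma C2on_coord U (i : 'I_N) (c : R) : C2on U (fun x : E => x ord0 i - c).
Proof.
have D j x : is_derive x (ebase j) (fun x : E => x ord0 i - c) ((ebase j : E) ord0 i).
  rewrite -[x]addr0 -(scale0r (ebase j)); apply/is_derive_line.
  have -> : (fun s : R => (x + s *: (ebase j : E)) ord0 i - c) =
      (fun s : R => (x ord0 i - c) + s * (ebase j : E) ord0 i).
    by apply/funext => s; rewrite mxE mxE addrAC.
  by apply: is_derive_eq; rewrite scaler0 !add0r [_%:A]mulr1 [LHS]mul1r.
have pdE j : pd j (fun x : E => x ord0 i - c) = fun _ => (ebase j : E) ord0 i.
  by apply/funext => x; have [_ <-] := D j x.
split.
- move=> x _; have /differentiable_continuous cx := differentiable_coord x ord0 i.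
  exact: (continuousB cx (@cst_continuous _ _ c _)).
- move=> x _ j; split; first by have [] := D j x.
  by rewrite pdE; exact: cst_continuous.
- by move=> j; rewrite pdE; exact: C1on_cst.
Qed.

Lemma C2on_sum U (I : Type) (r : seq I) (F : I -> E -> R) : open U ->
  (forall i, C2on U (F i)) -> C2on U (fun x => \sum_(i <- r) F i x).
Proof.
move=> oU cF; elim: r => [|i r IH].
  apply: (C2on_eq oU _ (C2on_cst U 0)) => x _; by rewrite big_nil.
have [c _ _] := C2on_lin 1 1 oU (cF i) IH.
by apply: (C2on_eq oU _ c) => x _; rewrite big_cons !mul1r.
Qed.

Definition sqdist p x : R := \sum_i (x ord0 i - p ord0 i) ^+ 2.

Lemma C2on_sqdist U p : open U -> C2on U (sqdist p).
Proof.
move=> oU; apply: (C2on_sum _ oU) => i.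
by have [] := C2on_sqr oU (C2on_coord U i (p ord0 i)).
Qed.

Lemma sqdist_ge0 p x : 0 <= sqdist p x.
Proof. by apply: sumr_ge0 => i _; rewrite sqr_ge0. Qed.

(** The norm of a row vector is the maximum norm; the Euclidean distance is
    used because its square is smooth. *)
Lemma sqdist_ge p x : `|x - p| ^+ 2 <= sqdist p x.
Proof.
rewrite -(sqr_sqrtr (sqdist_ge0 p x)) ler_sqr ?nnegrE ?sqrtr_ge0//.
rewrite [leLHS]/Num.Def.normr/= mx_normrE; apply: bigmax_le; first exact: sqrtr_ge0.
move=> [i j] _ /=; rewrite !mxE ord1 -sqrtr_sqr ler_wsqrtr//.
rewrite /sqdist (bigD1 j)//= lerDl; apply: sumr_ge0 => k _; exact: sqr_ge0.
Qed.

Lemma sqdist_line p (i : 'I_N) (k : R) : sqdist p (p + k *: ebase i) = k ^+ 2.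
Proof.
rewrite /sqdist (bigD1 i)//= big1 ?addr0.
  by rewrite !mxE !eqxx mulr1 addrAC subrr add0r.
by move=> j ji; rewrite !mxE eqxx (negbTE ji) mulr0 addr0 subrr expr0n.
Qed.

Lemma closed_normball p (r : R) : closed [set x : E | `|x - p| <= r].
Proof.
apply: (preimage_closed (f := fun x : E => `|x - p|) (D := [set y : R | y <= r])).
  move=> y _; apply: (@continuous_comp _ _ _ (fun x : E => x - p)).
    have ci : {for y, continuous (fun x : E => x)} by exact: cvg_id.
    exact: (continuousB ci (@cst_continuous _ _ p _)).
  exact: norm_continuous.
exact: closed_le.
Qed.

Lemma open_normball p (r : R) : open [set x : E | `|x - p| < r].
Proof.
have -> : [set x : E | `|x - p| < r] = ball p r.
  by apply/seteqP; split=> x; rewrite -ball_normE/= distrC.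
exact: ball_open.
Qed.

Lemma cvg_big_sum (T I : Type) (r : seq I) (F : set_system T) (FF : Filter F)
    (f : I -> T -> R) (l : I -> R) : (forall i, f i x @[x --> F] --> l i) ->
  \sum_(i <- r) f i x @[x --> F] --> \sum_(i <- r) l i.
Proof.
move=> fl; apply: cvg_big => //; exact: add_continuous.
Qed.

(** The filter F is a neighbourhood filter restricted to the closed domain:
    the coefficients are only known to be continuous from inside. *)
Lemma ellop_cvg U (F : set_system E) (FF : Filter F) f (c : E -> @coef R N) (c0 : coef) p :
  open U -> C2on U f -> U p -> F --> nbhs p ->
  (forall i j, (c x).1 i j @[x --> F] --> c0.1 i j) ->
  (forall j, (c x).2 j @[x --> F] --> c0.2 j) ->
  ellop (c x) f x @[x --> F] --> ellop c0 f p.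
Proof.
move=> oU [f0 f1 f2] Up Fp c1 c2.
apply: cvgD; apply: cvg_big_sum => i; last first.
  apply: cvgM; first exact: c2.
  apply: (cvg_trans _ (f1 p Up i).2); exact: cvg_app.
apply: cvg_big_sum => j; apply: cvgM; first exact: c1.
apply: (cvg_trans _ (f2 j p Up i).2); exact: cvg_app.
Qed.

End Distance.

(** * Hopf's boundary lemma *)

Section Hopf.
Context {R : realType} {N : nat}.
Local Notation E := 'rV[R]_N.
Implicit Types (f g u rho : E -> R) (x v w p : E) (Om U : set E).

Lemma open_sub_interior_closure Om : open Om -> Om `<=` (closure Om)°.
Proof.
move=> oO x Ox; apply: filterS (@subset_closure _ Om) _.
exact: open_nbhs_nbhs.
Qed.

Lemma has_cont_ext_continuous Om f x : open Om -> has_cont_ext Om f -> Om x ->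
  {for x, continuous f}.
Proof.
move=> oO [g [cg fg]] Ox; refine (open_continuous_eq oO Ox (fun y Oy => esym (fg y Oy)) _).
refine (within_continuous_at cg _); exact: open_sub_interior_closure.
Qed.

Lemma has_cont_ext_bounded (T : topologicalType) (A : set T) (f : T -> R) :
  compact (closure A) -> has_cont_ext A f ->
  exists2 M : R, 0 <= M & forall y : T, A y -> `|f y| <= M.
Proof.
move=> cA [g [cg fg]]; have [M M0 MP] := compact_abs_bound cA cg.
exists M; first exact: M0.
by move=> y Ay; rewrite (fg _ Ay); apply/MP/subset_closure.
Qed.

Lemma uniform_family_bound (I : finType) (T : Type) (A : set T) (f : I -> T -> R) :
  (forall i, exists2 M : R, 0 <= M & forall y : T, A y -> `|f i y| <= M) ->
  exists2 M : R, 0 <= M & forall i (y : T), A y -> `|f i y| <= M.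
Proof.
move=> H.
have /choice[M MP] : forall i, exists M : R, 0 <= M /\ forall y : T, A y -> `|f i y| <= M.
  by move=> i; have [M M0 MP] := H i; exists M.
exists (\sum_i M i); first by apply: sumr_ge0 => i _; have [] := MP i.
move=> i x Ax; apply: le_trans ((MP i).2 x Ax) _.
by rewrite (bigD1 i)//= lerDl; apply: sumr_ge0 => j _; have [] := MP j.
Qed.

Definition derivs_le Om u (M : R) := forall x, Om x ->
  (forall i, `|pd i u x| <= M) /\ (forall i j, `|pd i (pd j u) x| <= M).

Lemma derivs_le_ext Om u : compact (closure Om) ->
  (forall i, has_cont_ext Om (pd i u)) ->
  (forall i j, has_cont_ext Om (pd i (pd j u))) ->
  exists2 M : R, 0 <= M & derivs_le Om u M.
Proof.
move=> cO e1 e2.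
have [M1 M10 M1P] := uniform_family_bound (fun i => has_cont_ext_bounded cO (e1 i)).
have [M2 M20 M2P] := uniform_family_bound (f := fun (ij : 'I_N * 'I_N) x =>
  pd ij.1 (pd ij.2 u) x) (fun ij => has_cont_ext_bounded cO (e2 ij.1 ij.2)).
exists (M1 + M2); first exact: addr_ge0.
move=> x Ox; split=> [i|i j].
  by apply: le_trans (M1P i x Ox) _; rewrite lerDl.
by apply: le_trans (M2P (i, j) x Ox) _; rewrite lerDr.
Qed.

Lemma C2_closure_C2on Om u : open Om -> C2_closure Om u -> C2on Om u.
Proof.
move=> oO [c0 d1 e1 d2 e2]; split.
- move=> x Ox; refine (within_continuous_at c0 _); exact: open_sub_interior_closure.
- move=> x Ox i; split; first exact: d1.
  exact: has_cont_ext_continuous oO (e1 i) Ox.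
- move=> j x Ox i; split; first exact: d2.
  exact: has_cont_ext_continuous oO (e2 i j) Ox.
Qed.

Definition elliptic_at (theta : R) (A : 'I_N -> 'I_N -> R) :=
  forall eta : 'I_N -> R,
    theta * (\sum_i eta i ^+ 2) <= \sum_i \sum_j A i j * eta i * eta j.

Lemma gram_form (A : 'I_N -> 'I_N -> R) (eta : 'I_N -> R) :
  \sum_i \sum_j A i j * (eta i * eta j) = \sum_i \sum_j A i j * eta i * eta j.
Proof. by apply: eq_bigr => i _; apply: eq_bigr => j _; rewrite mulrA. Qed.

(** Hopf's barrier - rho + K rho^2 - |x - p|^2, rho being a local defining
    function. At p the operator applied to it equals
    - L rho + 2 K (A grad rho, grad rho) - L |x - p|^2, which is positive for K
    large since grad rho does not vanish and A is elliptic; continuity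
    propagates the sign. *)
Lemma boundary_barrier Om (c : E -> @coef R N) U rho p (theta : R) :
  open U -> U p -> C2on U rho -> rho p = 0 -> 0 < theta -> elliptic_at theta (c p).1 ->
  (forall i j, (c x).1 i j @[x --> within (closure Om) (nbhs p)] --> (c p).1 i j) ->
  (forall j, (c x).2 j @[x --> within (closure Om) (nbhs p)] --> (c p).2 j) ->
  (exists i, pd i rho p != 0) ->
  exists K : R, 0 <= K /\
  let beta (x : E) : R := 1 * (- 1 * rho x + K * rho x ^+ 2) + - 1 * sqdist p x in
  C2on U beta /\
  \forall x \near within (closure Om) (nbhs p), 0 < ellop (c x) beta x.
Proof.
move=> oU Up cr rp t0 ell c1 c2 [k kP].
have [cr2 _ _] := C2on_sqr oU cr.
have cq := C2on_sqdist p oU.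
pose s := \sum_i (pd i rho p) ^+ 2.
have s0 : 0 < s.
  rewrite /s (bigD1 k)//=; apply: ltr_pwDl; first by rewrite exprn_even_gt0.
  by apply: sumr_ge0 => i _; exact: sqr_ge0.
pose l1 := ellop (c p) rho p; pose l2 := ellop (c p) (sqdist p) p.
(* K makes the value at p at least 1 *)
pose K := (`|l1| + `|l2| + 1) / (2 * theta * s).
have K0 : 0 <= K.
  apply: divr_ge0; first by rewrite !addr_ge0.
  by apply: mulr_ge0; [apply: mulr_ge0; [|exact: ltW]|exact: ltW].
exists K; split; first exact: K0.
have [cb1 _ _] := C2on_lin (- 1) K oU cr cr2.
have [cb _ _] := C2on_lin 1 (- 1) oU cb1 cq.
split; first exact: cb.
have FF : Filter (within (closure Om) (nbhs p)) by exact: within_filter.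
have /cvgr_gt : ellop (c x) (fun x => 1 * (- 1 * rho x + K * rho x ^+ 2) + - 1 * sqdist p x) x
   @[x --> within (closure Om) (nbhs p)] -->
   ellop (c p) (fun x => 1 * (- 1 * rho x + K * rho x ^+ 2) + - 1 * sqdist p x) p.
  by apply: (ellop_cvg FF oU cb Up) => //; exact: cvg_within.
apply.
rewrite (ellop_lin 1 (- 1) (c p) oU cb1 cq Up) (ellop_lin (- 1) K (c p) oU cr cr2 Up).
rewrite (ellop_sqr (c p) oU cr Up) gram_form rp -/l1 -/l2.
have := ell (fun i => pd i rho p); rewrite -/s.
move: (\sum_i _) => S hS.
have : K * (2 * (theta * s)) <= K * (2 * S).
  by rewrite ler_wpM2l// ler_wpM2l.
have -> : K * (2 * (theta * s)) = `|l1| + `|l2| + 1.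
  by rewrite /K mulrA divfK// !mulf_neq0 ?gt_eqF.
have := ler_norm l1; have := ler_norm l2.
clearbody K l1 l2; rewrite mulr0 mul0r add0r; lra.
Qed.

Lemma sublevel_closure_le0 Om U rho x : open U -> C2on U rho ->
  Om `&` U = [set x | U x /\ rho x < 0] -> closure Om x -> U x -> rho x <= 0.
Proof.
move=> oU [r0 _ _] OU clx Ux; rewrite leNgt; apply/negP => rx.
have rc : rho @ x --> rho x := r0 x Ux.
have n1 : nbhs x [set y | 0 < rho y] by move/cvgr_gt : rc; apply.
have n2 : nbhs x U by exact: open_nbhs_nbhs.
have [y [Oy [/= ry Uy]]] := clx _ (filterI n1 n2).
have : (Om `&` U) y by [].
by rewrite OU => -[_]; rewrite ltNge ltW.
Qed.

(** Maximum principle for C u - beta in the part of the closed domain within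
    distance r of p. The barrier is negative at boundary points other than p,
    so on the rest of the boundary of that region it can only be positive at
    interior points of the domain, where u is bounded away from 0 by
    compactness; a large C therefore makes the difference nonnegative there. *)
Lemma hopf_comparison Om (c : E -> @coef R N) u U rho p (K lam : R) :
  open Om -> compact (closure Om) -> {within closure Om, continuous u} ->
  C2on Om u -> (forall x, Om x -> 0 < u x) ->
  (forall x, (closure Om `\` Om) x -> u x = 0) ->
  0 <= lam -> (forall x, Om x -> - ellop (c x) u x = lam * u x) ->
  (forall x, Om x -> gram (c x).1) ->
  open U -> U p -> C2on U rho -> Om `&` U = [set x | U x /\ rho x < 0] -> rho p = 0 ->
  let beta (x : E) : R := 1 * (- 1 * rho x + K * rho x ^+ 2) + - 1 * sqdist p x in
  C2on U beta ->
  (\forall x \near within (closure Om) (nbhs p), 0 < ellop (c x) beta x) ->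
  exists r C : R, [/\ 0 < r, 0 < C &
    forall x, closure Om x -> `|x - p| <= r -> beta x <= C * u x].
Proof.
move=> oO cO cu c2u upos u0 lam0 eqn gr oU Up cr OU rp beta cb Lb.
have n2 : nbhs p U by exact: open_nbhs_nbhs.
have /nbhs_ballP[e /= e0 eP] :
    nbhs p (U `&` [set x | closure Om x -> 0 < ellop (c x) beta x]).
  by apply: filterI; [exact: n2|exact: Lb].
pose r := e / 2.
have r0 : 0 < r by rewrite divr_gt0.
have rP x : `|x - p| <= r -> U x /\ (closure Om x -> 0 < ellop (c x) beta x).
  move=> xr; apply: eP; rewrite -ball_normE/= distrC; apply: le_lt_trans xr _.
  by rewrite ltr_pdivrMr// ltr_pMr// ltr1n.
have rle0 x : closure Om x -> U x -> rho x <= 0.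
  exact: sublevel_closure_le0 oU cr OU.
have ucl x : closure Om x -> 0 <= u x.
  move=> clx; have [Ox|nOx] := pselect (Om x); first exact/ltW/upos.
  by rewrite u0.
(* at a boundary point rho = 0, so only - |x - p|^2 is left of the barrier *)
have bpos x : closure Om x -> `|x - p| <= r -> 0 < `|x - p| -> 0 <= beta x -> Om x.
  move=> clx /rP[Ux _] xp bx.
  have : rho x < 0.
    rewrite lt_neqAle rle0// andbT; apply/eqP => rx.
    move: bx; rewrite /beta rx; have := sqdist_ge p x.
    have : 0 < `|x - p| ^+ 2 by rewrite exprn_gt0.
    rewrite expr0n/= ; lra.
  move=> rx; have [] : (Om `&` U) x by rewrite OU.
  by [].
pose W := closure Om `&` [set x | `|x - p| <= r].
have cW : compact W.
  by apply: (compact_closedI cO); exact: closed_normball.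
have cbW : {within W, continuous beta}.
  have [b0 _ _] := cb.
  by apply: continuous_at_within => x [_ /rP[Ux _]]; exact: b0.
have cuW : {within W, continuous u}.
  by apply: continuous_subspaceW cu => x [].
(* positive on the part of the sphere in the closure, and equal to u where the
   barrier is nonnegative *)
pose F (x : E) : R := 1 * u x + 1 * (1 * `|beta x| + - 1 * beta x).
pose S := W `&` ~` [set x | `|x - p| < r].
have [m m0 mP] : exists2 m, 0 < m & forall x, S x -> m <= F x.
  apply: compact_pos_min.
  - by apply: compact_closedI cW _; apply: open_closedC; exact: open_normball.
  - have SW : S `<=` W by move=> x [].
    have cnb := within_continuous_norm cbW.
    apply: (continuous_subspaceW SW).
    exact: (within_continuous_lin cuW (within_continuous_lin cnb cbW)).
  - move=> x [[clx /= xr] /negP]; rewrite -leNgt => xr'.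
    have [bx|bx] := leP 0 (beta x).
      rewrite /F (ger0_norm bx).
      have := upos x (bpos x clx xr (lt_le_trans r0 xr') bx); lra.
    by have := ucl x clx; rewrite /F (ltr0_norm bx); lra.
have [B B0 BP] := compact_abs_bound cW cbW.
exists r, ((B + 1) / m); split=> //.
  by rewrite divr_gt0// ltr_wpDl.
set C := (B + 1) / m; have C0 : 0 < C by rewrite divr_gt0// ltr_wpDl.
move=> x clx xr.
pose v := fun x => C * u x + - 1 * beta x.
suff : 0 <= v x by rewrite /v; lra.
have cv : {within W, continuous v} by apply: within_continuous_lin.
have W0 : W !=set0 by exists x.
have [y /set_mem Wy yP] := compact_EVT_min W0 cW cv.
apply: le_trans (yP x _); last by apply/mem_set; split.
have [cly /= yr] := Wy.
have bp0 : beta p = 0.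
  rewrite /beta rp expr0n/= !mulr0 add0r mulr0 add0r.
  by rewrite /sqdist big1 ?mulr0// => i _; rewrite subrr expr0n.
rewrite leNgt; apply/negP => vy.
have by0 : 0 < beta y.
  have : 0 <= C * u y by rewrite mulr_ge0 ?ucl// ltW.
  by move: vy; rewrite /v; lra.
have yp : 0 < `|y - p|.
  rewrite lt_neqAle normr_ge0 andbT eq_sym; apply/negP; rewrite normr_eq0 subr_eq0 => /eqP yE.
  by move: by0; rewrite yE bp0 ltxx.
have Oy : Om y by apply: bpos => //; exact: ltW.
have yr' : `|y - p| < r.
  rewrite ltNge; apply/negP => ry.
  have Sy : S y by split; [exact: Wy|apply/negP; rewrite -leNgt].
  have um : m <= u y by have := mP y Sy; rewrite /F (gtr0_norm by0); lra.
  have : B + 1 <= C * u y.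
    by rewrite /C mulrAC ler_pdivlMr// ler_wpM2l ?addr_ge0.
  have := BP y Wy; have := ler_norm (beta y).
  by move: vy; rewrite /v; lra.
have [Uy Ly] := rP y yr.
have oI : open (Om `&` U) by exact: openI.
have cuI : C2on (Om `&` U) u by apply: C2on_subset c2u => z [].
have cbI : C2on (Om `&` U) beta by apply: C2on_subset cb => z [].
have Iy : (Om `&` U) y by split.
have [cvI _ _] := C2on_lin C (- 1) oI cuI cbI.
have vmin : \forall z \near y, v y <= v z.
  have : nbhs y (Om `&` [set x | `|x - p| < r]).
    apply: filterI; first exact: open_nbhs_nbhs.
    by apply: open_nbhs_nbhs; split; [exact: open_normball|exact: yr'].
  apply: filterS => z [Oz /= zr]; apply/yP/mem_set.
  by split; [exact: subset_closure|exact: ltW].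
have := ellop_min oI cvI Iy (gr y Oy) vmin.
rewrite (ellop_lin C (- 1) (c y) oI cuI cbI Iy).
have := eqn y Oy; have := Ly cly.
have : 0 <= C * (lam * u y)
  by apply: mulr_ge0; [exact: ltW|apply: mulr_ge0; [exact: lam0|exact: ucl]].
set L := ellop _ u y; set Lb' := ellop _ beta y => h1 h2 h3.
have -> : L = - (lam * u y) by rewrite -h3 opprK.
rewrite mulrN; clearbody Lb'; lra.
Qed.

End Hopf.

Section HopfGradient.
Context {R : realType} {N : nat}.
Local Notation E := 'rV[R]_N.
Implicit Types (f g u rho : E -> R) (x v w p : E) (Om U : set E).

(** Hopf's lemma. Entering the domain from p along the coordinate direction in
    which rho decreases, the barrier grows at a linear rate, and so does u by
    comparison. A zero of the extended derivative at p would make u grow at a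
    smaller rate, by the mean value theorem. *)
Lemma hopf_gradient Om (c : E -> @coef R N) u U rho p (lam theta : R) (i : 'I_N)
    (g : E -> R) :
  open Om -> compact (closure Om) -> {within closure Om, continuous u} ->
  C2on Om u -> (forall x, Om x -> 0 < u x) ->
  (forall x, (closure Om `\` Om) x -> u x = 0) ->
  0 <= lam -> (forall x, Om x -> - ellop (c x) u x = lam * u x) ->
  (forall x, Om x -> gram (c x).1) -> (closure Om `\` Om) p ->
  0 < theta -> elliptic_at theta (c p).1 ->
  (forall i j, (c x).1 i j @[x --> within (closure Om) (nbhs p)] --> (c p).1 i j) ->
  (forall j, (c x).2 j @[x --> within (closure Om) (nbhs p)] --> (c p).2 j) ->
  open U -> U p -> C2on U rho -> Om `&` U = [set x | U x /\ rho x < 0] ->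
  pd i rho p != 0 ->
  {within closure Om, continuous g} -> (forall x, Om x -> pd i u x = g x) ->
  g p != 0.
Proof.
move=> oO cO cu c2u upos u0 lam0 eqn gr [clp nOp] t0 ell c1 c2 oU Up cr OU dn0 cg gE.
have rp : rho p = 0.
  apply/eqP; rewrite eq_le (sublevel_closure_le0 oU cr OU clp Up)/=.
  rewrite leNgt; apply/negP => rp; apply: nOp.
  by have [] : (Om `&` U) p by rewrite OU.
have [K [K0 [cb Lb]]] := boundary_barrier oU Up cr rp t0 ell c1 c2 (ex_intro _ i dn0).
have [r [C [r0 C0 hC]]] := hopf_comparison oO cO cu c2u upos u0 lam0 eqn gr oU Up cr OU
  rp cb Lb.
apply/negP => /eqP gp0.
pose d := `|pd i rho p|; have d0 : 0 < d by rewrite normr_gt0.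
pose k := - Num.sg (pd i rho p).
(* eta is the coordinate direction, with the sign that makes rho decrease *)
have kd : k * pd i rho p = - d.
  by rewrite /k /d mulNr -normrEsg.
have k1 : `|k| = 1 by rewrite /k normrN normr_sg dn0.
pose eta : E := k *: ebase i.
have Deta : is_derive p eta rho (- d).
  rewrite -kd; apply/is_derive_scale/derivableP; by have [_ r1 _] := cr; have [] := r1 p Up i.
have Nline (t : R) : 0 < t -> `|t *: eta + p - p| <= t * (`|eta| + 1).
  move=> t_gt0; rewrite addrK normrZ gtr0_norm// ler_wpM2l ?lerDl//; exact: ltW.
pose B := `|eta| + 1; have B0 : 0 < B by rewrite ltr_wpDl.
(* the constant d / 2 < d leaves room for the error of the difference quotient *)
have /cvgr_le/(_ (- (d / 2))) : (fun h => h^-1 *: ((rho \o shift p) (h *: eta) - rho p))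
    @ 0^' --> - d.
  by have [cv <-] := Deta; exact: cv.
rewrite ltrN2 ltr_pdivrMr// ltr_pMr// ltr1n => /(_ isT)[e1 /= e10 e1P].
have nU : nbhs p U by exact: open_nbhs_nbhs.
have ng : nbhs p [set x | closure Om x -> `|g x| <= d / (8 * C)].
  have cgp : g x @[x --> within (closure Om) (nbhs p)] --> g p.
    by move/subspace_continuousP : cg => /(_ p clp).
  move: cgp; rewrite gp0 => /cvgr0_norm_le.
  by apply; rewrite divr_gt0// mulr_gt0.
have /nbhs_ballP[e2 /= e20 e2P] :
    nbhs p (U `&` [set x | closure Om x -> `|g x| <= d / (8 * C)]).
  exact: filterI nU ng.
pose t := Num.min (Num.min (e1 / 2) (d / 4)) (Num.min (e2 / (2 * B)) (r / B)).
have t_gt0 : 0 < t by rewrite !lt_min !divr_gt0// mulr_gt0.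
have te1 : t < e1.
  by rewrite /t !gt_min ltr_pdivrMr// ltr_pMr// ltr1n.
have td : t <= d / 4 by rewrite /t !ge_min lexx !orbT.
have te2 : t * B < e2.
  have h : t <= e2 / (2 * B) by rewrite /t !ge_min lexx !orbT.
  apply: le_lt_trans (ler_wpM2r (ltW B0) h) _.
  rewrite invfM mulrA divfK ?gt_eqF//.
  by rewrite ltr_pdivrMr// ltr_pMr// ltr1n.
have tr : t * B <= r by rewrite -ler_pdivlMr// /t !ge_min lexx !orbT.
have inU (s : R) : 0 < s -> s <= t -> U (s *: eta + p) /\
   (closure Om (s *: eta + p) -> `|g (s *: eta + p)| <= d / (8 * C)).
  move=> s0 st; apply: e2P; rewrite -ball_normE/= distrC.
  apply: le_lt_trans (Nline s s0) _; apply: le_lt_trans te2.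
  by rewrite ler_wpM2r// ltW.
have rhos (s : R) : 0 < s -> s <= t -> rho (s *: eta + p) <= - (d / 2) * s.
  move=> s0 st; have := e1P s; rewrite /= sub0r normrN gtr0_norm//.
  move=> /(_ (le_lt_trans st te1) (lt0r_neq0 s0)); rewrite rp subr0.
  by rewrite [_ *: _]mulrC ler_pdivrMr.
have inO (s : R) : 0 < s -> s <= t -> Om (s *: eta + p).
  move=> s0 st; have [] : (Om `&` U) (s *: eta + p); last by [].
  rewrite OU; split; first by have [] := inU s s0 st.
  apply: le_lt_trans (rhos s s0 st) _; rewrite mulNr oppr_lt0 mulr_gt0// divr_gt0//.
have lower : d / 4 * t <= C * u (t *: eta + p).
  apply: le_trans (hC (t *: eta + p) _ _); last first.
  - exact: le_trans (Nline t t_gt0) tr.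
  - by apply/subset_closure/inO.
  have -> : sqdist p (t *: eta + p) = t ^+ 2.
    by rewrite addrC scalerA sqdist_line exprMn -(real_normK (num_real k)) k1 expr1n mulr1.
  have := rhos t t_gt0 (lexx _).
  have : 0 <= K * rho (t *: eta + p) ^+ 2 by rewrite mulr_ge0// sqr_ge0.
  have : t ^+ 2 <= t * (d / 4) by rewrite expr2 ler_pM2l.
  lra.
have u00 : u p = 0 by apply: u0.
have cF : {within `[0, t], continuous (fun s : R => u (s *: eta + p))}.
  apply: (@within_comp_continuous R E R [set` `[0, t]] (closure Om)
    (fun s : R => s *: eta + p) u).
  - apply: continuous_subspaceT => s.
    have sc : {for s, continuous (fun s : R => s *: eta)} by exact: scalel_continuous.
    exact: (continuousD sc (@cst_continuous _ _ p _)).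
  - move=> s /=; rewrite in_itv/= => /andP[]; rewrite le_eqVlt => /orP[/eqP <- _|s0 st].
      by rewrite scale0r add0r.
    by apply/subset_closure/inO.
  - exact: cu.
have [z] : exists2 z, z \in `]0, t[ & u (t *: eta + p) - u (0 *: eta + p) =
    k * g (z *: eta + p) * (t - 0).
  apply: (@MVT R (fun s => u (s *: eta + p)) (fun s => k * g (s *: eta + p)) 0 t t_gt0).
  - move=> s; rewrite in_itv/= => /andP[s0 st].
    have Os := inO s s0 (ltW st).
    have Ds : is_derive (p + s *: eta) eta u (k * g (p + s *: eta)).
      rewrite -gE; last by rewrite addrC.
      apply/is_derive_scale/derivableP; have [_ u1 _] := c2u.
      by rewrite addrC; have [] := u1 _ Os i.
    under [X in is_derive _ _ X]funext => w do rewrite addrC.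
    rewrite [s *: _ + _]addrC; exact/is_derive_line.
  - exact: cF.
rewrite in_itv/= => /andP[z0 zt]; rewrite scale0r add0r u00 !subr0 => uE.
have [_ gz] := inU z z0 (ltW zt).
have {}gz := gz (subset_closure (inO z z0 (ltW zt))).
have : C * u (t *: eta + p) <= d / 8 * t.
  rewrite uE mulrA ler_pM2r//.
  apply: (@le_trans _ _ (C * (d / (8 * C)))); last first.
    by rewrite mulrC invfM mulrA divfK ?gt_eqF.
  rewrite ler_pM2l//; apply: le_trans gz.
  by apply: le_trans (ler_norm _) _; rewrite normrM k1 mul1r.
have : 0 < d * t by exact: mulr_gt0.
lra.
Qed.

End HopfGradient.

(** * A minimum principle on cylinders, and barriers near the boundary *)

Section Parabolic.
Context {R : realType} {N : nat}.
Local Notation E := 'rV[R]_N.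
Implicit Types (f g u z : E -> R) (x : E) (Om G : set E).

(** A minimum over a time interval may sit at its right end, where only the
    left difference quotients carry information. *)
Lemma left_min_derive1_le0 (f : R -> R) (s t0 : R) : t0 < s -> derivable f s 1 ->
  (forall t, t0 <= t <= s -> f s <= f t) -> derive1 f s <= 0.
Proof.
move=> ts df fmin; rewrite leNgt; apply/negP => d0.
have cv : (fun h : R => h^-1 *: ((f \o shift s) (h *: (1 : R)) - f s)) @ 0^' --> derive1 f s.
  by rewrite derive1E; exact: df.
move/cvgr_gt : cv => /(_ _ d0)[e /= e0 eP].
pose h := Num.min (e / 2) (s - t0).
have h0 : 0 < h by rewrite lt_min divr_gt0// subr_gt0.
have he : h < e by rewrite gt_min ltr_pdivrMr// ltr_pMr// ltr1n.
have := eP (- h); rewrite /= sub0r opprK gtr0_norm// oppr_eq0 gt_eqF//.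
move=> /(_ he isT); rewrite [- h *: 1]mulr1 invrN scaleNr oppr_gt0.
rewrite [_ *: _]mulrC pmulr_llt0 ?invr_gt0// subr_lt0 ltNge => /negP; apply.
apply: fmin; rewrite addrC gerDl oppr_le0 (ltW h0) andbT.
by rewrite lerBrDr addrC -lerBrDr /h ge_min lexx orbT.
Qed.

(** A minimum principle covering at once the initial value problem, the
    time-periodic problem and the elliptic problem: the only negative values
    allowed on the bottom of the cylinder are those attained again on its top. *)
Lemma parabolic_min_principle Om G (K : R -> E -> @coef R N) (v : E -> R -> R)
    (kappa t0 t1 : R) :
  open Om -> compact G -> 0 <= kappa -> t0 < t1 ->
  {within G `*` [set` `[t0, t1]], continuous (uncurry v)} ->
  (forall x, G x -> v x t0 < 0 -> v x t1 <= v x t0) ->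
  (forall x s, G x -> t0 <= s <= t1 -> v x s < 0 ->
     Om x /\ \forall y \near x, G y) ->
  (forall x s, G x -> Om x -> t0 < s -> s <= t1 -> v x s < 0 ->
     [/\ C2on Om (v^~ s), derivable (v x) s 1, gram (K s x).1 &
         0 < kappa * derive1 (v x) s - ellop (K s x) (v^~ s) x]) ->
  forall x s, G x -> t0 <= s <= t1 -> 0 <= v x s.
Proof.
move=> oO cG k0 t01 cv H0 H1 H2 x s Gx st.
set Q := G `*` _ in cv.
have cQ : compact Q by apply: compact_setX; [exact: cG|exact: segment_compact].
have Q0 : Q !=set0 by exists (x, s); split; [exact: Gx|rewrite /= in_itv/=; exact: st].
have [[x1 s1] /set_mem Q1 vmin] := compact_EVT_min Q0 cQ cv.
have {}vmin y t : G y -> t0 <= t <= t1 -> v x1 s1 <= v y t.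
  move=> Gy tt; apply: (vmin (y, t)); apply/mem_set.
  by split; [exact: Gy|rewrite /= in_itv/=; exact: tt].
apply: le_trans (vmin x s Gx st); rewrite leNgt; apply/negP => v1.
have [/= Gx1] := Q1; rewrite in_itv/= => s1t.
(* a negative minimum on the bottom is attained on the top as well *)
have [s2 [s2t0 s2t1 vs2]] : exists s2, [/\ t0 < s2, s2 <= t1 & v x1 s2 = v x1 s1].
  move/andP: s1t => [s1t0 s1t1].
  have [e|ne] := eqVneq s1 t0; last first.
    by exists s1; split=> //; rewrite lt_neqAle eq_sym ne.
  exists t1; split=> //; apply/le_anti/andP; split.
    by rewrite e; apply: H0 => //; rewrite -e.
  by apply: vmin => //; rewrite lexx ltW.
have s2t : t0 <= s2 <= t1 by rewrite s2t1 ltW.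
have v2 : v x1 s2 < 0 by rewrite vs2.
have [Ox1 nG] := H1 x1 s2 Gx1 s2t v2.
have [c2 dv gr] := H2 x1 s2 Gx1 Ox1 s2t0 s2t1 v2.
have dle : derive1 (v x1) s2 <= 0.
  apply: left_min_derive1_le0 s2t0 dv _ => t /andP[tt0 tt1].
  by rewrite vs2; apply: vmin => //; rewrite tt0 (le_trans tt1).
have Lge : 0 <= ellop (K s2 x1) (v^~ s2) x1.
  apply: ellop_min oO c2 Ox1 gr _.
  by apply: filterS nG => y Gy; rewrite vs2; apply: vmin.
have : kappa * derive1 (v x1) s2 <= 0 by rewrite mulr_ge0_le0.
lra.
Qed.

Lemma compact_sublevel (T : topologicalType) (A : set T) (f : T -> R) (a : R) :
  compact A -> {within A, continuous f} -> compact (A `&` [set y | f y <= a]).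
Proof.
move=> cA cf F PF FA; have FA' : F A by apply: filterS FA => y [].
have [y [Ay cly]] := cA F PF FA'; exists y; split; last exact: cly.
split=> //=; rewrite leNgt; apply/negP => fy.
have cfy : f t @[t --> within A (nbhs y)] --> f y.
  by move/subspace_continuousP : cf => /(_ y Ay).
have nV : nbhs y [set t | A t -> a < f t] by move/cvgr_gt : cfy; apply.
have [t [[At /= ft] Vt]] := cly _ _ FA nV.
by have := Vt At; rewrite ltNge ft.
Qed.

(** The pointwise properties of the operator on which all later constants
    depend; theta and M do not depend on the time, the point or the frequency. *)
Record admissible (theta M : R) (c : @coef R N) : Prop := Admissible {
  adm_gram : gram c.1;
  adm_elliptic : elliptic_at theta c.1;
  adm_bound2 : forall i j, `|c.1 i j| <= M;
  adm_bound1 : forall j, `|c.2 j| <= M }.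

(** Plays the role of the distance to the boundary: the gradient bound says that
    z leaves 0 at a linear rate. *)
Record boundary_coordinate Om z (M eta c : R) : Prop := BoundaryCoordinate {
  bc_C2 : C2on Om z;
  bc_cont : {within closure Om, continuous z};
  bc_pos : forall x, Om x -> 0 < z x;
  bc_zero : forall x, (closure Om `\` Om) x -> z x = 0;
  bc_derivs : derivs_le Om z M;
  bc_eta : 0 < eta;
  bc_c : 0 < c;
  bc_grad : forall x, Om x -> z x < eta -> c <= \sum_i pd i z x ^+ 2 }.

(** With K > 0 the sign sigma = 1 bends the coordinate up and gives subsolutions
    near the boundary, sigma = - 1 bends it down and gives supersolutions. *)
Definition bend (sigma K : R) z x : R := 1 * z x + (sigma * K) * z x ^+ 2.

(** The lower and the upper estimates are proved together: sigma = 1 stands for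
    bounds from below, and sigma = - 1 reverses all inequalities. *)
Definition is_sign (sigma : R) := sigma = 1 \/ sigma = - 1.

Lemma sign_sqr (sigma : R) : is_sign sigma -> sigma * sigma = 1.
Proof. by case=> ->; rewrite ?mulrNN mulr1. Qed.

Lemma bend_C2 Om z (sigma K : R) : open Om -> C2on Om z -> C2on Om (bend sigma K z).
Proof.
move=> oO cz; have [cz2 _ _] := C2on_sqr oO cz.
by have [cb _ _] := C2on_lin 1 (sigma * K) oO cz cz2; exact: cb.
Qed.

Lemma sign_bend_ellop Om z (sigma K : R) (c : coef) x : open Om -> is_sign sigma ->
  C2on Om z -> Om x ->
  sigma * ellop c (bend sigma K z) x = sigma * ellop c z x +
    2 * K * (z x * ellop c z x + \sum_i \sum_j c.1 i j * pd i z x * pd j z x).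
Proof.
move=> oO sg cz Ox; have [cz2 _ _] := C2on_sqr oO cz.
rewrite /bend (ellop_lin 1 (sigma * K) c oO cz cz2 Ox) (ellop_sqr c oO cz Ox) gram_form.
set L := ellop c z x; set S := \sum_i \sum_j _.
have -> : sigma * (1 * L + sigma * K * (2 * z x * L + 2 * S)) =
   sigma * L + sigma * sigma * (2 * K * (z x * L + S)) by ring.
by rewrite sign_sqr// mul1r.
Qed.

(** The quadratic term contributes 2 K (A grad z, grad z), at least
    2 K theta c0 where the gradient is bounded below; the other terms are
    bounded, and the one with factor K also carries the small factor z. *)
Lemma bend_ellop Om z (sigma K theta M Mz eta c0 : R) (c : coef) x : open Om ->
  is_sign sigma -> 0 <= K -> 0 <= theta -> 0 <= M ->
  boundary_coordinate Om z Mz eta c0 -> admissible theta M c -> Om x -> z x < eta ->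
  2 * K * (theta * c0 - z x * (M * (Mz * (N * N + N)%:R))) - M * (Mz * (N * N + N)%:R)
    <= sigma * ellop c (bend sigma K z) x.
Proof.
move=> oO sg K0 t0 M0 bz ac Ox zeta; rewrite (sign_bend_ellop K c oO sg (bc_C2 bz) Ox).
have [d1 d2] := bc_derivs bz Ox.
have := ellop_bound M0 (adm_bound2 ac) (adm_bound1 ac) d1 d2.
set C := M * _; set L := ellop c z x => LC.
have Ss := adm_elliptic ac (fun i => pd i z x).
have sc := bc_grad bz Ox zeta.
move: Ss; set S := \sum_i \sum_j _ => Ss.
have z0 := bc_pos bz Ox.
have sL : - C <= sigma * L.
  apply: le_trans (_ : - `|sigma * L| <= _); last by rewrite lerNl ler_normr lexx orbT.
  by rewrite lerN2 normrM; case: sg => ->; rewrite ?normrN normr1 mul1r.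
have : 2 * K * (theta * c0 - z x * C) <= 2 * K * (z x * L + S).
  apply: ler_wpM2l; first by rewrite mulr_ge0.
  rewrite addrC; apply: lerD; last first.
    by apply: le_trans Ss; rewrite ler_wpM2l.
  rewrite -mulrN ler_pM2l//; move: LC; rewrite ler_norml => /andP[]//.
lra.
Qed.

(** The strength S is obtained by choosing K first and then a layer so thin that
    the bent coordinate stays comparable to z. *)
Lemma bend_barrier Om z (theta M Mz eta0 c0 S : R) : open Om -> 0 < theta -> 0 <= M ->
  0 <= Mz -> boundary_coordinate Om z Mz eta0 c0 ->
  exists K eta : R, [/\ 0 < K, 0 < eta, eta <= 1, K * eta <= 2^-1 &
    forall sigma c x, is_sign sigma -> admissible theta M c -> Om x -> z x < eta ->
      S <= sigma * ellop c (bend sigma K z) x].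
Proof.
move=> oO t0 M0 Mz0 bz; have c00 := bc_c bz; have e0 := bc_eta bz.
pose C := M * (Mz * (N * N + N)%:R).
have C0 : 0 <= C by rewrite !mulr_ge0.
pose tc := theta * c0; have tc0 : 0 < tc by rewrite mulr_gt0.
pose K := (`|S| + C + 1) / tc.
have K0 : 0 < K by rewrite divr_gt0// ltr_wpDl// addr_ge0.
pose eta := Num.min (Num.min eta0 1) (Num.min (2^-1 / K) (tc / (2 * (C + 1)))).
have C10 : 0 < C + 1 by rewrite ltr_wpDl.
have et0 : 0 < eta by rewrite !lt_min e0 ltr01/= (divr_gt0 _ K0)// divr_gt0// mulr_gt0.
exists K, eta; split=> //.
- by rewrite /eta !ge_min lexx !orbT.
- by rewrite mulrC -ler_pdivlMr// /eta !ge_min lexx !orbT.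
move=> sigma c x sg ac Ox zeta.
have zeta0 : z x < eta0 by apply: lt_le_trans zeta _; rewrite /eta !ge_min lexx.
apply: le_trans (bend_ellop oO sg (ltW K0) (ltW t0) M0 bz ac Ox zeta0).
rewrite -/C -/tc.
have z0 := bc_pos bz Ox.
have zC : z x * C <= tc / 2.
  have h : z x <= tc / (2 * (C + 1)).
    by apply: le_trans (ltW zeta) _; rewrite /eta !ge_min lexx !orbT.
  apply: le_trans (ler_wpM2r C0 h) _.
  have -> : tc / (2 * (C + 1)) * C = tc / 2 * (C / (C + 1)).
    by rewrite invfM; ring.
  rewrite ler_piMr//; first by rewrite divr_ge0// ltW.
  by rewrite ler_pdivrMr// mul1r lerDl.
have : K * tc <= 2 * K * (tc - z x * C).
  have aux (a b d : R) : 0 < a -> b <= 2 * d -> a * b <= 2 * a * d.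
    by move=> a0 bd; rewrite -mulrA mulrCA ler_pM2l.
  by apply: aux => //; lra.
have -> : K * tc = `|S| + C + 1 by rewrite /K divfK// gt_eqF.
have := ler_norm S; lra.
Qed.

Lemma bend_ge z (sigma K eta : R) x : is_sign sigma -> 0 <= K -> K * eta <= 2^-1 ->
  0 <= z x <= eta -> z x / 2 <= bend sigma K z x <= 3 / 2 * z x.
Proof.
move=> sg K0 Ke /andP[z0 ze]; rewrite /bend.
have h : 0 <= K * z x ^+ 2 <= z x / 2.
  rewrite mulr_ge0 ?sqr_ge0//= expr2 mulrA mulrC ler_wpM2l//.
  by apply: le_trans Ke; rewrite ler_wpM2l.
by move: h; case: sg => -> /andP[h1 h2]; apply/andP; split; lra.
Qed.

End Parabolic.

(** * Growth at the boundary *)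

Section Comparison.
Context {R : realType} {N : nat} (Om : set 'rV[R]_N) (z : 'rV[R]_N -> R)
  (theta M Mz eta0 c0 : R) (oO : open Om) (cO : compact (closure Om))
  (t0 : 0 < theta) (M0 : 0 <= M) (Mz0 : 0 <= Mz)
  (bz : boundary_coordinate Om z Mz eta0 c0).
Local Notation E := 'rV[R]_N.
Local Notation adm := (admissible theta M).
Implicit Types (f g u : E -> R) (x : E) (phi : E -> R -> R) (c : E -> @coef R N)
  (L : R -> E -> @coef R N).

Lemma bc_ge0 x : closure Om x -> 0 <= z x.
Proof.
move=> clx; have [Ox|nOx] := pselect (Om x); first exact/ltW/(bc_pos bz Ox).
by rewrite (bc_zero bz).
Qed.

Lemma layer_compact (a : R) : compact (closure Om `&` [set y | z y <= a]).
Proof. exact: compact_sublevel cO (bc_cont bz). Qed.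

Lemma core_compact (a : R) : compact (closure Om `&` [set y | a <= z y]).
Proof.
have -> : [set y | a <= z y] = [set y | - z y <= - a].
  by apply/seteqP; split=> y /=; rewrite lerN2.
apply: compact_sublevel cO _ => x; apply: continuousN; exact: (bc_cont bz).
Qed.

Lemma layer_near (a : R) x : Om x -> z x < a ->
  \forall y \near x, (closure Om `&` [set y | z y <= a]) y.
Proof.
move=> Ox xa; have [z0 _ _] := bc_C2 bz.
have cz : z @ x --> z x := z0 x Ox.
have n1 : nbhs x [set y | z y < a] by move/cvgr_lt : cz; apply.
have n2 : nbhs x Om by exact: open_nbhs_nbhs.
apply: filterS (filterI n2 n1) => y [Oy /= ya].
by split; [exact: subset_closure|exact: ltW].
Qed.

(** All functions fed to the minimum principle have this shape: the solution and
    a time-independent function, each with a factor depending on time only. *)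
Lemma combination_slice phi g (a b : R -> R) x (s a' b' : R) :
  C2on Om (phi^~ s) -> C2on Om g -> Om x -> derivable (phi x) s 1 ->
  is_derive s (1 : R) a a' -> is_derive s (1 : R) b b' ->
  let v x s := a s * phi x s + b s * g x in
  [/\ C2on Om (v^~ s), derivable (v x) s 1,
   derive1 (v x) s = a' * phi x s + a s * derive1 (phi x) s + b' * g x &
   forall k : coef, ellop k (v^~ s) x = a s * ellop k (phi^~ s) x + b s * ellop k g x].
Proof.
move=> cp cg Ox dp da db v.
have [cv _ _] := C2on_lin (a s) (b s) oO cp cg.
have Dv : is_derive s (1 : R) (v x) (a' * phi x s + a s * derive1 (phi x) s + b' * g x).
  have da1 := is_deriveM da (derivableP dp).
  have db1 := is_deriveM db (is_derive_cst (g x) s (1 : R)).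
  apply: (is_derive_eq (is_deriveD da1 db1)).
  rewrite derive1E /= -[a s *: _]/(a s * _) -[phi x s *: _]/(phi x s * _).
  by rewrite scaler0 add0r -[g x *: _]/(g x * _); ring.
split.
- exact: cv.
- by have [] := Dv.
- by rewrite derive1E; have [_ ->] := Dv.
- by move=> k; rewrite -(ellop_lin (a s) (b s) k oO cp cg Ox).
Qed.

(** The interface between the equation and the comparison arguments. Principal
    eigenfunctions of a fixed operator are included, as stationary solutions,
    for every value of kappa. *)
Record periodic_solution (kappa : R) L (mu : R) phi : Prop := PeriodicSolution {
  ps_cont : {within closure Om `*` [set` `[0, 1]], continuous (uncurry phi)};
  ps_C2 : forall s, 0 <= s <= 1 -> C2on Om (phi^~ s);
  ps_dt : forall x s, Om x -> 0 <= s <= 1 -> derivable (phi x) s 1;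
  ps_pos : forall x s, Om x -> 0 <= s <= 1 -> 0 < phi x s;
  ps_zero : forall x s, (closure Om `\` Om) x -> 0 <= s <= 1 -> phi x s = 0;
  ps_per : forall x, Om x -> phi x 0 = phi x 1;
  ps_derivs : exists2 B : R, 0 <= B & derivs_le Om (phi^~ 0) B;
  ps_eq : forall x s, Om x -> 0 <= s <= 1 ->
    kappa * derive1 (phi x) s - ellop (L s x) (phi^~ s) x = mu * phi x s }.

Lemma within_cst_in_time (A : set E) (B : set R) g : {within A, continuous g} ->
  {within A `*` B, continuous (fun p : E * R => g p.1)}.
Proof.
move=> cg; apply: (@within_comp_continuous _ _ _ (A `*` B) A fst g).
- by apply: continuous_subspaceT => p; exact: cvg_fst.
- by move=> p [].
- exact: cg.
Qed.

Lemma within_time (A : set E) (B : set R) (a : R -> R) : continuous a ->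
  {within A `*` B, continuous (fun p : E * R => a p.2)}.
Proof.
move=> ca; apply: (@within_comp_continuous _ _ _ (A `*` B) setT snd a).
- by apply: continuous_subspaceT => p; exact: cvg_snd.
- by [].
- exact: continuous_subspaceT.
Qed.

Lemma within_mul (T : topologicalType) (A : set T) (f g : T -> R) :
  {within A, continuous f} -> {within A, continuous g} ->
  {within A, continuous (fun y => f y * g y)}.
Proof. by move=> cf cg y; exact: (continuousM (cf y) (cg y)). Qed.

Lemma combination_within phi g (A : set E) (B : set R) (a b : R -> R) :
  {within A `*` B, continuous (uncurry phi)} -> {within A, continuous g} ->
  continuous a -> continuous b ->
  {within A `*` B, continuous (uncurry (fun x s => a s * phi x s + b s * g x))}.
Proof.
move=> cp cg ca cb.
have c1 := within_mul (@within_time A B a ca) cp.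
have c2 := within_mul (@within_time A B b cb) (@within_cst_in_time A B g cg).
have c3 := within_continuous_lin (a := 1) (b := 1) c1 c2.
have -> : uncurry (fun x s => a s * phi x s + b s * g x) =
  (fun p => 1 * (a p.2 * uncurry phi p) + 1 * (b p.2 * g p.1)).
  by apply/funext => -[y s]/=; rewrite !mul1r.
exact: c3.
Qed.

Lemma within_slice (A : set E) (B : set R) phi (s : R) : B s ->
  {within A `*` B, continuous (uncurry phi)} -> {within A, continuous (fun x => phi x s)}.
Proof.
move=> Bs cp; apply: (@within_comp_continuous E (E * R)%type R A (A `*` B)
  (fun x => (x, s)) (uncurry phi)).
- apply: continuous_subspaceT => x.
  have h : (y, s) @[y --> x] --> (x, s).
    move=> W [[P Q] /= [nP nQ] PQ]; apply: filterS nP => y Py.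
    by apply: PQ; split=> //=; exact: nbhs_singleton.
  exact: h.
- by [].
- exact: cp.
Qed.

Lemma bend_within sigma K : {within closure Om, continuous (bend sigma K z)}.
Proof.
exact: within_continuous_lin (bc_cont bz) (within_continuous_sqr (bc_cont bz)).
Qed.

Lemma is_derive_const (k s : R) : is_derive s (1 : R) (fun _ : R => k) 0.
Proof. exact: is_derive_cst. Qed.

(** A large multiple m of the coordinate bent down is a supersolution in a
    boundary layer, dominates u on the inner edge of the layer and equals it on
    the boundary; away from the layer z is bounded below. *)
Lemma boundary_upper_bound u c (C1 : R) : (forall x, Om x -> adm (c x)) -> C2on Om u ->
  {within closure Om, continuous u} ->
  (forall x, (closure Om `\` Om) x -> u x = 0) ->
  (forall x, Om x -> `|ellop (c x) u x| <= C1) ->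
  exists2 C : R, 0 < C & forall x, Om x -> u x <= C * z x.
Proof.
move=> ac c2u cu u0 uC1.
have [K [eta [K0 e0 e1 Ke bar]]] := bend_barrier 1 oO t0 M0 Mz0 bz.
have [B B0 BP] := compact_abs_bound cO cu.
(* the first terms beat L u in the layer, the last one beats u where z = eta *)
pose m := `|C1| + 1 + 2 * B / eta.
have Be : 0 <= 2 * B / eta by exact: divr_ge0 (mulr_ge0 (ler0n _ _) B0) (ltW e0).
have m0 : 0 < m by apply: ltr_wpDr Be _; rewrite ltr_wpDl.
have mB : 2 * B / eta <= m - 1.
  by rewrite /m; have := normr_ge0 C1; lra.
have me : B < m * (eta / 2).
  have : 2 * B / eta * (eta / 2) <= (m - 1) * (eta / 2).
    by rewrite ler_wpM2r// divr_ge0// ltW.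
  have -> : 2 * B / eta * (eta / 2) = B by field; rewrite gt_eqF.
  have : 0 < eta / 2 by rewrite divr_gt0.
  lra.
pose w := bend (- 1) K z.
have cw : C2on Om w := bend_C2 (- 1) K oO (bc_C2 bz).
have sg : is_sign (- 1 : R) by right.
have wle x : closure Om x -> z x <= eta -> z x / 2 <= w x <= 3 / 2 * z x.
  by move=> clx ze; apply: bend_ge sg (ltW K0) Ke _; rewrite bc_ge0.
pose G := closure Om `&` [set y | z y <= eta].
pose v x (s : R) := m * w x + - 1 * u x.
have vin x : G x -> v x 0 < 0 -> Om x /\ z x < eta.
  move=> [clx /= ze] vx; have [Ox|nOx] := pselect (Om x); last first.
    have := wle x clx ze; rewrite (bc_zero bz (conj clx nOx)) mul0r => /andP[w1 w2].
    by move: vx; rewrite /v u0// ltNge; have := mulr_ge0 (ltW m0) w1; lra.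
  split=> //; rewrite lt_neqAle ze andbT; apply/eqP => zE.
  have /andP[w1 _] := wle x clx ze; rewrite zE in w1.
  have := ler_wpM2l (ltW m0) w1; have := BP x clx; have := ler_norm (u x).
  by move: vx; rewrite /v; lra.
have cuG : {within G, continuous u} by apply: continuous_subspaceW cu => x [].
have cwG : {within G, continuous w}.
  have GO : G `<=` closure Om by move=> x [].
  exact: (continuous_subspaceW GO (@bend_within (- 1) K)).
have cc (k : R) : continuous (fun _ : R => k) by exact: cst_continuous.
have cwc : {within G `*` [set` `[0, 1]], continuous (uncurry (fun x (s : R) => w x))}.
  have -> : uncurry (fun x (s : R) => w x) = (fun p : E * R => w p.1).
    by apply/funext => -[].
  exact: within_cst_in_time.
have cv : {within G `*` [set` `[0, 1]], continuous (uncurry v)}.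
  exact: (@combination_within (fun x _ => w x) u G [set` `[0, 1]]
    (fun _ => m) (fun _ => - 1) cwc cuG (cc m) (cc (- 1))).
have H0 : forall x, G x -> v x 0 < 0 -> v x 1 <= v x 0.
  by move=> x _ _; exact: lexx.
have H1 : forall x s, G x -> 0 <= s <= 1 -> v x s < 0 ->
    Om x /\ \forall y \near x, G y.
  move=> x s Gx _ vx; have [Ox zx] := vin x Gx vx; split; first exact: Ox.
  exact: layer_near.
have H2 : forall x s, G x -> Om x -> 0 < s -> s <= 1 -> v x s < 0 ->
    [/\ C2on Om (v^~ s), derivable (v x) s 1, gram (c x).1 &
     0 < 0 * derive1 (v x) s - ellop (c x) (v^~ s) x].
  move=> x s Gx Ox _ _ vx; have [_ zx] := vin x Gx vx.
  have dw : derivable (fun _ : R => w x) s 1 by exact: derivable_cst.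
  have [v1 v2 v3 v4] := combination_slice (phi := fun x _ => w x) cw c2u Ox dw
    (is_derive_const m s) (is_derive_const (- 1) s).
  split; [exact: v1|exact: v2|exact: (adm_gram (ac x Ox))|].
  rewrite mul0r sub0r (v4 (c x)).
  have := bar (- 1) (c x) x sg (ac x Ox) Ox zx; rewrite -/w => Lw.
  have := ler_wpM2l (ltW m0) Lw; have := uC1 x Ox; rewrite ler_norml => /andP[h1 h2].
  have : 1 <= m - C1 + 0.
    by rewrite /m; have := ler_norm C1; lra.
  move: h1 h2; set L1 := ellop (c x) u x; set L2 := ellop (c x) _ x; lra.
have vge0 : forall x s, G x -> 0 <= s <= 1 -> 0 <= v x s.
  exact: (@parabolic_min_principle R N Om G (fun _ => c) v 0 0 1 oO (@layer_compact eta)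
    (lexx 0) ltr01 cv H0 H1 H2).
exists (3 / 2 * m + B / eta).
  by apply: ltr_wpDr; rewrite ?divr_ge0// ?mulr_gt0// ltW.
move=> x Ox; have clx : closure Om x by exact: subset_closure.
have z0 := bc_pos bz Ox; have [ze|ze] := leP (z x) eta.
  have := vge0 x 0 (conj clx ze); rewrite lexx ler01 => /(_ isT).
  have /andP[_ w2] := wle x clx ze; have := ler_wpM2l (ltW m0) w2.
  rewrite /v mulrDl; have : 0 <= B / eta * z x.
    by rewrite !mulr_ge0// ?invr_ge0 ltW.
  lra.
have h : B <= B / eta * z x.
  by rewrite mulrAC ler_pdivlMr// ler_wpM2l// ltW.
have := BP x clx; have := ler_norm (u x); rewrite mulrDl.
have : 0 <= 3 / 2 * m * z x by rewrite !mulr_ge0 ?ltW.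
lra.
Qed.

End Comparison.

Section BoundaryBounds.
Context {R : realType} {N : nat} (Om : set 'rV[R]_N) (z : 'rV[R]_N -> R)
  (theta M Mz eta0 c0 : R) (oO : open Om) (cO : compact (closure Om))
  (t0 : 0 < theta) (M0 : 0 <= M) (Mz0 : 0 <= Mz)
  (bz : boundary_coordinate Om z Mz eta0 c0).
Local Notation E := 'rV[R]_N.
Local Notation adm := (admissible theta M).
Implicit Types (f g u psi : E -> R) (x : E) (phi : E -> R -> R) (c : E -> @coef R N)
  (L : R -> E -> @coef R N).

Lemma is_derive_kexp (k l s0 s : R) :
  is_derive s (1 : R) (fun s => k * expR (l * (s - s0))) (l * (k * expR (l * (s - s0)))).
Proof.
have d1 : is_derive s (1 : R) (fun s => l * (s - s0)) l.
  apply: (is_derive_eq (is_deriveZ l (is_deriveB (is_derive_id s (1 : R))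
    (is_derive_cst s0 s (1 : R))))).
  by rewrite subr0 [LHS]mulr1.
have d2 := @is_derive1_comp R expR _ s _ _ (is_derive_expR (l * (s - s0))) d1.
apply: (is_derive_eq (is_deriveZ k d2)).
by rewrite -[_ *: _]/(k * _) mulrA mulrC.
Qed.

Lemma continuous_kexp (k l s0 : R) : continuous (fun s => k * expR (l * (s - s0))).
Proof.
move=> s; apply/differentiable_continuous/derivable1_diffP.
by have [] := is_derive_kexp k l s0 s.
Qed.

Lemma cst_continuousR (k : R) : continuous (fun _ : R => k).
Proof. exact: cst_continuous. Qed.

(** If mu were negative, - phi would satisfy a strict inequality that the
    minimum principle excludes, periodicity replacing the initial condition. *)
Lemma periodic_solution_ge0 (kappa mu : R) L phi : Om !=set0 -> 0 <= kappa ->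
  (forall s x, 0 <= s <= 1 -> Om x -> adm (L s x)) ->
  periodic_solution Om kappa L mu phi -> 0 <= mu.
Proof.
move=> [x0 Ox0] k0 aL ps; rewrite leNgt; apply/negP => mu0.
pose v x s := - 1 * phi x s + 0 * (0 : R).
have vE x s : v x s = - phi x s by rewrite /v mul0r addr0 mulN1r.
have c0w : {within closure Om, continuous (fun _ : E => 0 : R)}.
  by apply: continuous_subspaceT => x; exact: cst_continuous.
have cv : {within closure Om `*` [set` `[0, 1]], continuous (uncurry v)}.
  exact: (@combination_within _ _ phi (fun _ => 0 : R) (closure Om) [set` `[0, 1]]
    (fun _ => - 1) (fun _ => 0) (ps_cont ps) c0w
    (@cst_continuousR (- 1)) (@cst_continuousR 0)).
have int x s : closure Om x -> 0 <= s <= 1 -> v x s < 0 -> Om x.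
  move=> clx s01 vx; have [|nOx] := pselect (Om x); first by [].
  by move: vx; rewrite vE (ps_zero ps (conj clx nOx) s01) oppr0 ltxx.
have z01 : (0 : R) <= (0 : R) <= 1 by apply/andP; split; [exact: lexx|exact: ler01].
have H0 : forall x, closure Om x -> v x 0 < 0 -> v x 1 <= v x 0.
  move=> x clx vx; have Ox := int x 0 clx z01 vx.
  by rewrite !vE (ps_per ps Ox).
have H1 : forall x s, closure Om x -> 0 <= s <= 1 -> v x s < 0 ->
    Om x /\ \forall y \near x, closure Om y.
  move=> x s clx s01 vx; have Ox := int x s clx s01 vx; split; first exact: Ox.
  exact: open_sub_interior_closure.
have H2 : forall x s, closure Om x -> Om x -> 0 < s -> s <= 1 -> v x s < 0 ->
    [/\ C2on Om (v^~ s), derivable (v x) s 1, gram (L s x).1 &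
     0 < kappa * derive1 (v x) s - ellop (L s x) (v^~ s) x].
  move=> x s _ Ox s0 s1 vx; have s01 : 0 <= s <= 1 by rewrite s1 ltW.
  have [v1 v2 v3 v4] := combination_slice oO (ps_C2 ps s01) (C2on_cst Om 0) Ox
    (ps_dt ps Ox s01) (is_derive_const (- 1) s) (is_derive_const 0 s).
  split; [exact: v1|exact: v2|exact: (adm_gram (aL s x s01 Ox))|].
  rewrite v3 (v4 (L s x)) !mul0r add0r !addr0 mulN1r mulrN mulN1r -opprB opprK addrC.
  have := ps_eq ps Ox s01; have := ps_pos ps Ox s01 => p0 e.
  have : mu * phi x s < 0 by rewrite nmulr_rlt0.
  by rewrite -e; lra.
have := @parabolic_min_principle R N Om (closure Om) L v kappa 0 1 oO cO k0 ltr01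
  cv H0 H1 H2 x0 0 (subset_closure Ox0) z01.
by rewrite vE leNgt oppr_lt0 (ps_pos ps).
Qed.

(** A small multiple of the coordinate bent up is a strict subsolution in a
    boundary layer and stays below phi on its inner edge. Since mu is
    nonnegative, phi is a supersolution. The comparison runs over a full period
    and needs no initial inequality. *)
Lemma boundary_lower_bound (kappa mu : R) L phi : Om !=set0 -> 0 <= kappa ->
  (forall s x, 0 <= s <= 1 -> Om x -> adm (L s x)) ->
  periodic_solution Om kappa L mu phi ->
  exists2 C : R, 0 < C & forall x, Om x -> C * z x <= phi x 0.
Proof.
move=> On0 k0 aL ps; have mu0 := periodic_solution_ge0 On0 k0 aL ps.
have [K [eta [K0 e0 e1 Ke bar]]] := bend_barrier 1 oO t0 M0 Mz0 bz.
have z_ge0 := bc_ge0 bz.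
pose w := bend 1 K z.
have cw : C2on Om w := bend_C2 1 K oO (bc_C2 bz).
have sg : is_sign (1 : R) by left.
have wle x : closure Om x -> z x <= eta -> z x / 2 <= w x <= 3 / 2 * z x.
  by move=> clx ze; apply: bend_ge sg (ltW K0) Ke _; rewrite z_ge0.
pose G := closure Om `&` [set y | z y <= eta].
pose A := closure Om `&` [set y | eta <= z y].
have AO x : A x -> Om x.
  move=> [clx /= ze]; have [|nOx] := pselect (Om x); first by [].
  by move: ze; rewrite (bc_zero bz)// leNgt e0.
have [m m0 mP] : exists2 m : R, 0 < m & forall p, (A `*` [set` `[0, 1]]) p -> m <= uncurry phi p.
  apply: compact_pos_min.
  - apply: compact_setX; last exact: segment_compact.
    exact: (core_compact (a := eta) cO bz).
  - by apply: continuous_subspaceW (ps_cont ps) => -[y s] /= [[cy _] h].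
  - move=> [y s] [/= Ay]; rewrite in_itv/= => s01; exact: (ps_pos ps (AO y Ay) s01).
have {}mP x s : A x -> 0 <= s <= 1 -> m <= phi x s.
  by move=> Ax s01; apply: (mP (x, s)); split; rewrite /= ?in_itv.
(* on the inner edge w <= 3 / 2, so that m / 2 * w stays below m <= phi *)
pose v x (s : R) := 1 * phi x s + - (m / 2) * w x.
have vin x s : G x -> 0 <= s <= 1 -> v x s < 0 -> Om x /\ z x < eta.
  move=> [clx /= ze] s01 vx; have [Ox|nOx] := pselect (Om x); last first.
    have := wle x clx ze; rewrite (bc_zero bz (conj clx nOx)) mulr0 => /andP[w1 w2].
    move: vx; rewrite /v (ps_zero ps (conj clx nOx) s01) ltNge.
    have : m / 2 * w x <= 0 by rewrite mulr_ge0_le0// divr_ge0// ltW.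
    by move=> h /negP; case; lra.
  split=> //; rewrite lt_neqAle ze andbT; apply/eqP => zE.
  have /andP[_ w2] := wle x clx ze; rewrite zE in w2.
  have mp : m <= phi x s by apply: mP => //; split=> //=; rewrite zE.
  have : m / 2 * w x <= m / 2 * (3 / 2).
    rewrite ler_wpM2l ?divr_ge0 ?(ltW m0)//; apply: le_trans w2 _.
    by rewrite ler_piMr.
  by move: vx; rewrite /v; lra.
have GO : G `<=` closure Om by move=> x [].
have cpG : {within G `*` [set` `[0, 1]], continuous (uncurry phi)}.
  by apply: continuous_subspaceW (ps_cont ps) => -[y s] [/= Gy h]; split => //; exact: GO.
have cwG : {within G, continuous w} :=
  continuous_subspaceW GO (bend_within (sigma := 1) (K := K) bz).
have cv : {within G `*` [set` `[0, 1]], continuous (uncurry v)}.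
  exact: (@combination_within _ _ phi w G [set` `[0, 1]]
    (fun _ => 1) (fun _ => - (m / 2)) cpG cwG (@cst_continuousR 1) (@cst_continuousR (- (m / 2)))).
have z01 : (0 : R) <= (0 : R) <= 1 by apply/andP; split; [exact: lexx|exact: ler01].
have H0 : forall x, G x -> v x 0 < 0 -> v x 1 <= v x 0.
  move=> x Gx vx; have [Ox _] := vin x 0 Gx z01 vx.
  by rewrite /v (ps_per ps Ox) lexx.
have H1 : forall x s, G x -> 0 <= s <= 1 -> v x s < 0 ->
    Om x /\ \forall y \near x, G y.
  move=> x s Gx s01 vx; have [Ox zx] := vin x s Gx s01 vx; split; first exact: Ox.
  exact: (layer_near oO bz).
have H2 : forall x s, G x -> Om x -> 0 < s -> s <= 1 -> v x s < 0 ->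
    [/\ C2on Om (v^~ s), derivable (v x) s 1, gram (L s x).1 &
     0 < kappa * derive1 (v x) s - ellop (L s x) (v^~ s) x].
  move=> x s Gx Ox s0 s1 vx; have s01 : 0 <= s <= 1 by rewrite s1 ltW.
  have [_ zx] := vin x s Gx s01 vx.
  have [v1 v2 v3 v4] := combination_slice oO (ps_C2 ps s01) cw Ox
    (ps_dt ps Ox s01) (is_derive_const 1 s) (is_derive_const (- (m / 2)) s).
  split; [exact: v1|exact: v2|exact: (adm_gram (aL s x s01 Ox))|].
  rewrite v3 (v4 (L s x)) !mul0r add0r !addr0 !mul1r.
  have := ps_eq ps Ox s01; have p0 := ps_pos ps Ox s01.
  have : 0 <= mu * phi x s by rewrite mulr_ge0// ltW.
  have := bar 1 (L s x) x sg (aL s x s01 Ox) Ox zx; rewrite mul1r -/w => Lw.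
  have m20 : 0 < m / 2 by rewrite divr_gt0.
  have := ler_wpM2l (ltW m20) Lw.
  set L1 := ellop _ w x; set L2 := ellop _ _ x; set L3 := kappa * _; lra.
have vge0 : forall x s, G x -> 0 <= s <= 1 -> 0 <= v x s.
  exact: (@parabolic_min_principle R N Om G L v kappa 0 1 oO (layer_compact (a := eta) cO bz)
    k0 ltr01 cv H0 H1 H2).
have [B B0 BP] := compact_abs_bound cO (bc_cont bz).
have B1 : 0 < B + 1 by rewrite ltr_wpDl.
exists (Num.min (m / 4) (m / (B + 1))); first by rewrite lt_min !divr_gt0.
move=> x Ox; have clx : closure Om x by exact: subset_closure.
have z0 := bc_pos bz Ox; have [ze|ze] := leP (z x) eta.
  apply: (@le_trans _ _ (m / 4 * z x)); first by rewrite ler_wpM2r ?(ltW z0)// ge_min lexx.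
  have := vge0 x 0 (conj clx ze) z01.
  have /andP[w1 _] := wle x clx ze; have m20 : 0 < m / 2 by rewrite divr_gt0.
  have := ler_wpM2l (ltW m20) w1; rewrite /v; lra.
apply: (@le_trans _ _ (m / (B + 1) * z x)).
  by rewrite ler_wpM2r ?(ltW z0)// ge_min lexx orbT.
apply: (@le_trans _ _ m); last by apply: mP => //; split=> //=; exact: ltW.
rewrite mulrAC ler_pdivrMr// ler_wpM2l ?(ltW m0)//.
by have := BP x clx; have := ler_norm (z x); lra.
Qed.

End BoundaryBounds.

(** * Comparison over a time interval and over a period *)

Section ProfileComparison.
Context {R : realType} {N : nat} (Om : set 'rV[R]_N) (z : 'rV[R]_N -> R)
  (theta M Mz eta0 c0 : R) (oO : open Om) (cO : compact (closure Om))
  (t0 : 0 < theta) (M0 : 0 <= M) (Mz0 : 0 <= Mz)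
  (bz : boundary_coordinate Om z Mz eta0 c0).
Local Notation E := 'rV[R]_N.
Local Notation adm := (admissible theta M).
Implicit Types (f g u psi : E -> R) (x : E) (phi : E -> R -> R) (c : E -> @coef R N)
  (L : R -> E -> @coef R N).

(** The function exp(beta (s - s0)) psi with kappa beta = mu - sigma r is a
    subsolution (sigma = 1) or a supersolution (sigma = - 1) of the equation
    satisfied by phi, and it vanishes on the boundary like phi. The extra factor
    exp(- gamma (s - s0)) makes the inequality strict where the difference is
    negative. *)
Lemma profile_comparison (sigma kappa mu r m s0 s1 : R) L phi psi :
  is_sign sigma -> 0 < kappa ->
  (forall s x, 0 <= s <= 1 -> Om x -> adm (L s x)) ->
  periodic_solution Om kappa L mu phi ->
  0 <= s0 -> s0 < s1 -> s1 <= 1 -> 0 <= m ->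
  C2on Om psi -> {within closure Om, continuous psi} ->
  (forall x, (closure Om `\` Om) x -> psi x = 0) ->
  (forall s x, s0 <= s <= s1 -> Om x -> - (sigma * ellop (L s x) psi x) <= r * psi x) ->
  (forall x, Om x -> sigma * m * psi x <= sigma * phi x s0) ->
  forall x, Om x ->
    sigma * m * expR ((mu - sigma * r) / kappa * (s1 - s0)) * psi x <= sigma * phi x s1.
Proof.
move=> sg k0 aL ps s00 s01 s11 m0 c2p cp p0 Lp hyp x Ox.
pose beta := (mu - sigma * r) / kappa; pose gamma := (`|r| + 1) / kappa.
have kb : kappa * beta = mu - sigma * r by rewrite mulrC divfK ?gt_eqF.
have kg : kappa * gamma = `|r| + 1 by rewrite mulrC divfK ?gt_eqF.
pose a (s : R) := sigma * expR (- (beta + gamma) * (s - s0)).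
pose b (s : R) := - (sigma * m) * expR (- gamma * (s - s0)).
pose v y s := a s * phi y s + b s * psi y.
have in01 s : s0 <= s <= s1 -> 0 <= s <= 1.
  by move=> /andP[h1 h2]; rewrite (le_trans s00 h1) (le_trans h2 s11).
have vbd y s : (closure Om `\` Om) y -> s0 <= s <= s1 -> v y s = 0.
  by move=> by_ st; rewrite /v (p0 _ by_) (ps_zero ps by_ (in01 s st)) !mulr0 addr0.
have s0i : s0 <= s0 <= s1 by rewrite lexx ltW.
have s1i : s0 <= s1 <= s1 by rewrite lexx ltW.
have cphi : {within closure Om `*` [set` `[s0, s1]], continuous (uncurry phi)}.
  apply: continuous_subspaceW (ps_cont ps) => -[y s] [/= cy].
  by rewrite in_itv/= => st; split=> //=; rewrite in_itv/= in01.
have cv : {within closure Om `*` [set` `[s0, s1]], continuous (uncurry v)}.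
  exact: (@combination_within _ _ phi psi (closure Om) [set` `[s0, s1]] a b
    cphi cp (@continuous_kexp _ _ _ _) (@continuous_kexp _ _ _ _)).
have int y s : closure Om y -> s0 <= s <= s1 -> v y s < 0 -> Om y.
  move=> cy st vy; have [|nOy] := pselect (Om y); first by [].
  by move: vy; rewrite vbd// ltxx.
have H0 : forall y, closure Om y -> v y s0 < 0 -> v y s1 <= v y s0.
  move=> y cy vy; have Oy := int y s0 cy s0i vy; move: vy.
  rewrite {1}/v /a /b subrr !mulr0 expR0 !mulr1 mulNr => vy.
  have := hyp y Oy; lra.
have H1 : forall y s, closure Om y -> s0 <= s <= s1 -> v y s < 0 ->
    Om y /\ \forall y' \near y, closure Om y'.
  move=> y s cy st vy; have Oy := int y s cy st vy; split; first exact: Oy.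
  exact: open_sub_interior_closure.
have H2 : forall y s, closure Om y -> Om y -> s0 < s -> s <= s1 -> v y s < 0 ->
    [/\ C2on Om (v^~ s), derivable (v y) s 1, gram (L s y).1 &
     0 < kappa * derive1 (v y) s - ellop (L s y) (v^~ s) y].
  move=> y s cy Oy ss0 ss1 vy; have st : s0 <= s <= s1 by rewrite ss1 ltW.
  have s01' := in01 s st.
  have [v1 v2 v3 v4] := combination_slice oO (ps_C2 ps s01') c2p Oy
    (ps_dt ps Oy s01') (is_derive_kexp sigma (- (beta + gamma)) s0 s)
    (is_derive_kexp (- (sigma * m)) (- gamma) s0 s).
  split; [exact: v1|exact: v2|exact: (adm_gram (aL s y s01' Oy))|].
  rewrite v3 (v4 (L s y)) -/(a s) -/(b s).
  have eq := ps_eq ps Oy s01'.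
  have e20 := expR_ge0 (- gamma * (s - s0)).
  have ineq := ler_wpM2l (mulr_ge0 m0 e20) (Lp s y st Oy).
  move: eq ineq vy; rewrite /v.
  set D := derive1 _ s; set L1 := ellop _ (phi^~ s) y; set L2 := ellop _ psi y.
  have -> : b s = - (sigma * (m * expR (- gamma * (s - s0)))) by rewrite /b mulNr mulrA.
  move: (m * expR _) (a s) (phi y s) (psi y) => me A P Q eq ineq vy.
  have -> : kappa * (- (beta + gamma) * A * P + A * D + - gamma * (- (sigma * me)) * Q)
      - (A * L1 + - (sigma * me) * L2) =
      A * (kappa * D - L1) - (kappa * beta + kappa * gamma) * (A * P)
      + kappa * gamma * (sigma * me * Q) + me * (sigma * L2) by ring.
  rewrite eq kb kg.
  have -> : A * (mu * P) - (mu - sigma * r + (`|r| + 1)) * (A * P)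
      + (`|r| + 1) * (sigma * me * Q) + me * (sigma * L2) =
      (sigma * r - (`|r| + 1)) * (A * P + - (sigma * me) * Q)
      + (sigma * sigma) * r * me * Q + me * (sigma * L2) by ring.
  rewrite (sign_sqr sg) mul1r.
  have : 0 < (sigma * r - (`|r| + 1)) * (A * P + - (sigma * me) * Q).
    rewrite nmulr_rgt0//; have : sigma * r <= `|r|; last by lra.
    by case: sg => ->; rewrite ?mul1r ?mulN1r ?ler_norm// ler_normr lexx orbT.
  move: ineq; lra.
have := @parabolic_min_principle R N Om (closure Om) L v kappa s0 s1 oO cO (ltW k0) s01
  cv H0 H1 H2 x s1 (subset_closure Ox) s1i.
have ep := expR_gt0 ((beta + gamma) * (s1 - s0)).
rewrite -(pmulr_rge0 _ ep) /v /a /b -/beta mulrDr.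
have e1 : expR ((beta + gamma) * (s1 - s0)) * expR (- (beta + gamma) * (s1 - s0)) = 1.
  by rewrite -expRD mulNr addrN expR0.
have e2 : expR ((beta + gamma) * (s1 - s0)) * expR (- gamma * (s1 - s0)) =
    expR (beta * (s1 - s0)).
  by rewrite -expRD -mulrDl addrK.
have -> : expR ((beta + gamma) * (s1 - s0)) *
    (sigma * expR (- (beta + gamma) * (s1 - s0)) * phi x s1) =
    expR ((beta + gamma) * (s1 - s0)) * expR (- (beta + gamma) * (s1 - s0)) *
    (sigma * phi x s1) by ring.
have -> : expR ((beta + gamma) * (s1 - s0)) *
    (- (sigma * m) * expR (- gamma * (s1 - s0)) * psi x) =
    - (sigma * m * (expR ((beta + gamma) * (s1 - s0)) * expR (- gamma * (s1 - s0)))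
       * psi x) by ring.
by rewrite e1 e2 mul1r; lra.
Qed.

End ProfileComparison.

Section Period.
Context {R : realType} {N : nat} (Om : set 'rV[R]_N) (z : 'rV[R]_N -> R)
  (theta M Mz eta0 c0 : R) (oO : open Om) (cO : compact (closure Om))
  (t0 : 0 < theta) (M0 : 0 <= M) (Mz0 : 0 <= Mz)
  (bz : boundary_coordinate Om z Mz eta0 c0).
Local Notation E := 'rV[R]_N.
Local Notation adm := (admissible theta M).
Implicit Types (f g u psi : E -> R) (x : E) (phi : E -> R -> R) (c : E -> @coef R N)
  (L : R -> E -> @coef R N).

(** For sigma = 1 the multiple m z lies below phi at time s, for sigma = - 1
    above. *)
Definition dominates (sigma m : R) phi (s : R) :=
  forall x, Om x -> sigma * (m * z x) <= sigma * phi x s.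

Lemma dominates_weaken (sigma m m' : R) phi s : sigma * m' <= sigma * m ->
  dominates sigma m phi s -> dominates sigma m' phi s.
Proof.
move=> mm h x Ox; apply: le_trans (h x Ox); rewrite !mulrA.
by rewrite ler_wpM2r// ltW// (bc_pos bz Ox).
Qed.

(** For sigma = 1, psi is a subsolution of the eigenvalue problem with rate r;
    for sigma = - 1 it is a supersolution with rate - r. *)
Record test_profile (sigma r k s0 s1 : R) L psi : Prop := TestProfile {
  tp_C2 : C2on Om psi;
  tp_cont : {within closure Om, continuous psi};
  tp_zero : forall x, (closure Om `\` Om) x -> psi x = 0;
  tp_lower : forall x, Om x -> expR (- k) * z x <= psi x;
  tp_upper : forall x, Om x -> psi x <= expR k * z x;
  tp_rate : forall s x, s0 <= s <= s1 -> Om x ->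
    - (sigma * ellop (L s x) psi x) <= r * psi x }.

(** Comparison with psi, restated for the coordinate z so that steps with
    different profiles can be chained. Going from z to psi and back costs a
    factor exp(2 k) in the unfavourable direction, whatever kappa is. *)
Lemma dominates_step (sigma kappa mu r k m s0 s1 : R) L phi psi :
  is_sign sigma -> 0 < kappa ->
  (forall s x, 0 <= s <= 1 -> Om x -> adm (L s x)) ->
  periodic_solution Om kappa L mu phi ->
  0 <= s0 -> s0 <= s1 -> s1 <= 1 -> 0 <= m -> 0 <= k ->
  test_profile sigma r k s0 s1 L psi ->
  dominates sigma m phi s0 ->
  dominates sigma (m * expR ((mu - sigma * r) / kappa * (s1 - s0) - sigma * (2 * k))) phi s1.
Proof.
move=> sg k0 aL ps s00; rewrite le_eqVlt => /orP[/eqP <- _ m0 kk tp|s01 s11 m0 kk tp dom].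
  rewrite subrr mulr0 add0r; apply: dominates_weaken.
  case: sg => ->; rewrite ?mul1r ?mulN1r ?opprK.
    by rewrite ler_piMr// -expR0 ler_expR oppr_le0 mulr_ge0.
  by rewrite lerN2 ler_peMr// -expR0 ler_expR mulr_ge0.
have hyp x : Om x -> sigma * (m * expR (- (sigma * k))) * psi x <= sigma * phi x s0.
  move=> Ox; apply: le_trans (dom x Ox).
  have -> : sigma * (m * expR (- (sigma * k))) * psi x =
    m * (sigma * (expR (- (sigma * k)) * psi x)) by ring.
  rewrite [leRHS]mulrCA ler_wpM2l//.
  have lo := tp_lower tp Ox; have up := tp_upper tp Ox.
  case: sg => ->; rewrite !(mul1r, mulN1r) ?opprK ?lerN2.
    by rewrite mulrC expRN ler_pdivrMr ?expR_gt0// mulrC.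
  by move: lo; rewrite expRN mulrC ler_pdivrMr ?expR_gt0// mulrC.
have mm : 0 <= m * expR (- (sigma * k)) by rewrite mulr_ge0// expR_ge0.
have res := profile_comparison oO cO sg k0 aL ps s00 s01 s11 mm (tp_C2 tp) (tp_cont tp)
  (tp_zero tp) (tp_rate tp) hyp.
move=> x Ox; apply: le_trans (res x Ox).
set B := (mu - sigma * r) / kappa * (s1 - s0).
have -> : expR (B - sigma * (2 * k)) = expR (- (sigma * k)) * expR B * expR (- (sigma * k)).
  by rewrite -!expRD; congr expR; ring.
have -> : sigma * (m * (expR (- (sigma * k)) * expR B * expR (- (sigma * k))) * z x) =
  m * expR (- (sigma * k)) * expR B * (sigma * (expR (- (sigma * k)) * z x)) by ring.
have -> : sigma * (m * expR (- (sigma * k))) * expR B * psi x =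
  m * expR (- (sigma * k)) * expR B * (sigma * psi x) by ring.
apply: ler_wpM2l; first by rewrite mulr_ge0// expR_ge0.
have lo := tp_lower tp Ox; have up := tp_upper tp Ox.
case: sg => ->; rewrite !(mul1r, mulN1r) ?opprK ?lerN2; first exact: lo.
exact: up.
Qed.

Lemma expR_growth_absurd (p q e : R) : 0 < p -> 0 < e ->
  (forall n : nat, p * expR (e *+ n) <= q) -> False.
Proof.
move=> p0 e0 h; pose n := (Num.truncn (q / (p * e))).+1.
have qn : q / (p * e) < n%:R by exact: truncnS_gt.
have := h n; rewrite leNgt => /negP; apply.
apply: (@lt_le_trans _ _ (p * (1 + e *+ n))); last by rewrite ler_pM2l// expR_ge1Dx.
move: qn; rewrite ltr_pdivrMr ?mulr_gt0// -mulr_natr; lra.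
Qed.

Lemma boundary_upper_bound_initial (kappa mu : R) L phi :
  (forall s x, 0 <= s <= 1 -> Om x -> adm (L s x)) ->
  periodic_solution Om kappa L mu phi ->
  exists2 C : R, 0 < C & forall x, Om x -> phi x 0 <= C * z x.
Proof.
move=> aL ps; have z01 : (0 : R) <= (0 : R) <= 1.
  by apply/andP; split; [exact: lexx|exact: ler01].
have [B B0 dB] := ps_derivs ps.
have cphi : {within closure Om, continuous (fun x => phi x 0)}.
  by apply: (within_slice _ (ps_cont ps)); rewrite /= in_itv.
apply: (@boundary_upper_bound _ _ _ _ _ _ _ _ _ oO cO t0 M0 Mz0 bz (fun x => phi x 0) (L 0)
  (M * (B * (N * N + N)%:R))).
- by move=> x; exact: aL.
- exact: (ps_C2 ps z01).
- exact: cphi.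
- by move=> x bx; exact: (ps_zero ps bx z01).
- move=> x Ox; have a := aL 0 x z01 Ox; have [d1 d2] := dB x Ox.
  exact: (ellop_bound M0 (adm_bound2 a) (adm_bound1 a) d1 d2).
Qed.

(** The solution returns to its initial value after one period, so the factor
    could be applied arbitrarily often; the two-sided bound by multiples of z
    would fail if it drifted in the favourable direction. *)
Lemma period_growth_le0 (sigma kappa mu D : R) L phi :
  Om !=set0 -> is_sign sigma -> 0 <= kappa ->
  (forall s x, 0 <= s <= 1 -> Om x -> adm (L s x)) ->
  periodic_solution Om kappa L mu phi ->
  (forall m, 0 <= m -> dominates sigma m phi 0 -> dominates sigma (m * expR D) phi 1) ->
  sigma * D <= 0.
Proof.
move=> On0 sg k0 aL ps step; have [x0 Ox0] := On0.
have z01 : (0 : R) <= (0 : R) <= 1.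
  by apply/andP; split; [exact: lexx|exact: ler01].
have iter m n : 0 <= m -> dominates sigma m phi 0 ->
    dominates sigma (m * expR (D *+ n)) phi 0.
  move=> m0 dm; elim: n => [|n IH]; first by rewrite mulr0n expR0 mulr1.
  have := step _ (mulr_ge0 m0 (expR_ge0 _)) IH.
  by rewrite -mulrA -expRD -mulrSr => h x Ox; rewrite (ps_per ps Ox); exact: h.
have z0 := bc_pos bz Ox0; have p0 := ps_pos ps Ox0 z01.
rewrite leNgt; apply/negP; case: sg iter {step} => -> iter; rewrite ?mul1r ?mulN1r => D0.
  have [C C0 Cz] := boundary_lower_bound oO cO t0 M0 Mz0 bz On0 k0 aL ps.
  have d0 : dominates 1 C phi 0 by move=> x Ox; rewrite !mul1r; exact: Cz.
  apply: (@expR_growth_absurd (C * z x0) (phi x0 0) D (mulr_gt0 C0 z0) D0) => n.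
  by have := iter C n (ltW C0) d0 x0 Ox0; rewrite !mul1r mulrAC.
have [C C0 Cz] := boundary_upper_bound_initial aL ps.
have d0 : dominates (- 1) C phi 0 by move=> x Ox; rewrite !mulN1r lerN2; exact: Cz.
apply: (@expR_growth_absurd (phi x0 0) (C * z x0) (- D) p0 D0) => n.
have := iter C n (ltW C0) d0 x0 Ox0; rewrite !mulN1r lerN2 mulNrn expRN.
by rewrite ler_pdivrMr ?expR_gt0// mulrAC.
Qed.

End Period.

(** * Profiles for nearby operators *)

Section Profile.
Context {R : realType} {N : nat} (Om : set 'rV[R]_N) (z : 'rV[R]_N -> R)
  (theta M Mz eta0 c0 : R) (oO : open Om) (cO : compact (closure Om))
  (t0 : 0 < theta) (M0 : 0 <= M) (Mz0 : 0 <= Mz)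
  (bz : boundary_coordinate Om z Mz eta0 c0).
Local Notation E := 'rV[R]_N.
Local Notation adm := (admissible theta M).
Implicit Types (f g u psi : E -> R) (x : E) (c : E -> @coef R N).

Lemma ellop_diff (c1 c2 : @coef R N) f x :
  ellop c1 f x - ellop c2 f x =
  ellop ((fun i j => c1.1 i j - c2.1 i j), (fun j => c1.2 j - c2.2 j)) f x.
Proof.
rewrite /ellop/= opprD addrACA; congr (_ + _).
  rewrite -sumrB; apply: eq_bigr => i _; rewrite -sumrB; apply: eq_bigr => j _.
  by rewrite mulrBl.
by rewrite -sumrB; apply: eq_bigr => j _; rewrite mulrBl.
Qed.

Lemma exp_bracket (a b : R) : 0 < a -> 0 < b ->
  exists k : R, [/\ 0 <= k, expR (- k) <= a & b <= expR k].
Proof.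
move=> a0 b0; exists (`|ln a| + `|ln b|); split; first exact: addr_ge0.
- rewrite -[leRHS]lnK// ler_expR.
  have := ler_norm (- ln a); rewrite normrN; have := normr_ge0 (ln b); lra.
- rewrite -[leLHS]lnK// ler_expR.
  have := ler_norm (ln b); have := normr_ge0 (ln a); lra.
Qed.

(** Away from the boundary layer there is no lower bound on the gradient of z,
    but the quadratic form is still nonnegative. *)
Lemma bend_ellop_lower (sigma K B : R) (c : @coef R N) x : is_sign sigma -> 0 <= K ->
  z x <= B -> adm c -> Om x ->
  - (1 + 2 * K * B) * (M * (Mz * (N * N + N)%:R)) <= sigma * ellop c (bend sigma K z) x.
Proof.
move=> sg K0 zB ac Ox; rewrite (sign_bend_ellop K c oO sg (bc_C2 bz) Ox).
have [d1 d2] := bc_derivs bz Ox.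
have LC := ellop_bound M0 (adm_bound2 ac) (adm_bound1 ac) d1 d2.
have S0 := adm_elliptic ac (fun i => pd i z x).
have {}S0 := le_trans (mulr_ge0 (ltW t0) (sumr_ge0 _ (fun i _ => sqr_ge0 (pd i z x)))) S0.
move: LC S0; set C := M * _; set L := ellop c z x; set S := \sum_i \sum_j _ => LC S0.
have zz := bc_pos bz Ox; have C0 : 0 <= C by apply: le_trans LC; exact: normr_ge0.
have [l1 l2] : - C <= L /\ L <= C by move: LC; rewrite ler_norml => /andP.
have sL : - C <= sigma * L by case: sg => ->; lra.
have zL : - (B * C) <= z x * L.
  have h1 : z x * C <= B * C by rewrite ler_wpM2r.
  have h2 : z x * - C <= z x * L by rewrite ler_pM2l.
  lra.
have : 2 * K * - (B * C) <= 2 * K * (z x * L + S).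
  by apply: ler_wpM2l; [rewrite mulr_ge0|lra].
lra.
Qed.

(** The eigenfunction u of the operator with coefficients c is perturbed to
    psi = u + delta (z + sigma K z^2). Replacing c by coefficients within tau
    changes L u by at most delta. In the boundary layer, where u is too small
    to absorb this error, the bent coordinate does, with strength
    2 |lam| + 2; in the core u is bounded below, and eps psi absorbs both this
    error and the terms with factor delta. *)
Lemma perturbed_profile (sigma lam eps Mu : R) u c :
  is_sign sigma -> 0 < eps ->
  (forall x, Om x -> adm (c x)) -> C2on Om u -> {within closure Om, continuous u} ->
  (forall x, Om x -> 0 < u x) -> (forall x, (closure Om `\` Om) x -> u x = 0) ->
  0 <= Mu -> derivs_le Om u Mu ->
  (forall x, Om x -> - ellop (c x) u x = lam * u x) ->
  exists psi (k tau : R), [/\ 0 <= k, 0 < tau &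
    forall s0 s1 (L : R -> E -> @coef R N),
      (forall s x, s0 <= s <= s1 -> Om x -> [/\ adm (L s x),
         (forall i j, `|(L s x).1 i j - (c x).1 i j| <= tau) &
         (forall j, `|(L s x).2 j - (c x).2 j| <= tau)]) ->
      test_profile Om z sigma (sigma * lam + eps) k s0 s1 L psi].
Proof.
move=> sg e0 ac c2u cu upos u0 Mu0 dMu eqn.
have [K [eta [K0 et0 et1 Ke bar]]] := bend_barrier (2 * `|lam| + 2) oO t0 M0 Mz0 bz.
pose w := bend sigma K z.
have cw : C2on Om w := bend_C2 sigma K oO (bc_C2 bz).
have cwc : {within closure Om, continuous w} := bend_within (sigma := sigma) (K := K) bz.
have [Zm Zm0 ZmP] := compact_abs_bound cO (bc_cont bz).
have [W W0 WP] := compact_abs_bound cO cwc.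
have zle x : Om x -> z x <= Zm.
  by move=> Ox; apply: le_trans (ler_norm _) (ZmP x (subset_closure Ox)).
have [Cu Cu0 CuP] : exists2 C : R, 0 < C & forall x, Om x -> u x <= C * z x.
  apply: (@boundary_upper_bound _ _ _ _ _ _ _ _ _ oO cO t0 M0 Mz0 bz u c
    (M * (Mu * (N * N + N)%:R)) ac c2u cu u0) => x Ox.
  have [d1 d2] := dMu x Ox.
  exact: (ellop_bound M0 (adm_bound2 (ac x Ox)) (adm_bound1 (ac x Ox)) d1 d2).
pose A := closure Om `&` [set y | eta <= z y].
have AO x : A x -> Om x.
  move=> [clx /= ze]; have [|nOx] := pselect (Om x); first by [].
  by move: ze; rewrite (bc_zero bz (conj clx nOx)) leNgt et0.
have [m m0 mP] : exists2 m : R, 0 < m & forall x, A x -> m <= u x.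
  apply: compact_pos_min.
  - exact: (core_compact (a := eta) cO bz).
  - by apply: continuous_subspaceW cu => x [].
  - by move=> x /AO; exact: upos.
pose Cw := (1 + 2 * K * Zm) * (M * (Mz * (N * N + N)%:R)).
have Cw0 : 0 <= Cw.
  apply: mulr_ge0; first by rewrite addr_ge0// !mulr_ge0// ltW.
  by rewrite !mulr_ge0.
pose Q := 1 + Cw + `|lam| * W.
have Q0 : 0 < Q.
  have : 0 <= `|lam| * W by rewrite mulr_ge0.
  by rewrite /Q; lra.
(* the first bound keeps psi >= m / 2 in the core; the second one makes the
   errors there, at most delta * Q, smaller than eps * psi *)
pose delta := Num.min (m / (2 * (W + 1))) (eps * m / (2 * Q)).
have W1 : 0 < W + 1 by rewrite ltr_wpDl.
have d0 : 0 < delta.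
  by rewrite lt_min !divr_gt0 ?mulr_gt0.
have dW : delta * W <= m / 2.
  have h : delta <= m / (2 * (W + 1)) by rewrite /delta ge_min lexx.
  apply: le_trans (ler_wpM2r W0 h) _.
  have -> : m / (2 * (W + 1)) * W = m / 2 * (W / (W + 1)) by rewrite invfM; ring.
  rewrite ler_piMr//; first by rewrite divr_ge0// ltW.
  by rewrite ler_pdivrMr// mul1r lerDl.
have dQ : delta * Q <= eps * m / 2.
  have h : delta <= eps * m / (2 * Q) by rewrite /delta ge_min lexx orbT.
  apply: le_trans (ler_wpM2r (ltW Q0) h) _.
  by rewrite invfM mulrA divfK ?gt_eqF.
pose T := Mu * (N * N + N)%:R.
have T0 : 0 <= T by rewrite mulr_ge0.
have T1 : 0 < T + 1 by rewrite ltr_wpDl.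
pose tau := delta / (T + 1).
have tau0 : 0 < tau by rewrite divr_gt0.
have tT : tau * T <= delta.
  by rewrite /tau mulrAC ler_pdivrMr// ler_wpM2l ?lerDl// ltW.
pose psi x := 1 * u x + delta * w x.
have wlay x : Om x -> z x < eta -> z x / 2 <= w x <= 3 / 2 * z x.
  move=> Ox ze; apply: bend_ge sg (ltW K0) Ke _.
  by rewrite !ltW// (bc_pos bz Ox).
have core x : Om x -> eta <= z x -> m <= u x.
  by move=> Ox ze; apply: mP; split=> //; exact: subset_closure.
have wabs x : Om x -> - W <= w x /\ w x <= W.
  move=> Ox; have := WP x (subset_closure Ox).
  by rewrite ler_norml => /andP.
have psiup x : Om x -> psi x <= (Cu + delta * (1 + K * Zm)) * z x.
  move=> Ox; have z0 := bc_pos bz Ox; have h := CuP x Ox.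
  have : w x <= (1 + K * Zm) * z x.
    have h1 : K * (z x * z x) <= K * (Zm * z x).
      by rewrite ler_wpM2l ?(ltW K0)// ler_wpM2r ?(ltW z0)// zle.
    have h2 : 0 <= K * (z x * z x) by rewrite !mulr_ge0 ?ltW.
    by rewrite /w /bend expr2; case: sg => ->; lra.
  by rewrite -(ler_pM2l d0) /psi; lra.
pose Z1 := Zm + 1; have Z10 : 0 < Z1 by rewrite ltr_wpDl.
have psilo x : Om x -> Num.min (delta / 2) (m / (2 * Z1)) * z x <= psi x.
  move=> Ox; have z0 := bc_pos bz Ox; have uu := upos x Ox.
  have [ze|ze] := ltP (z x) eta.
    apply: (@le_trans _ _ (delta / 2 * z x)).
      by rewrite ler_wpM2r ?(ltW z0)// ge_min lexx.
    have /andP[w1 _] := wlay x Ox ze; have := ler_wpM2l (ltW d0) w1.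
    by rewrite /psi; lra.
  apply: (@le_trans _ _ (m / (2 * Z1) * z x)).
    by rewrite ler_wpM2r ?(ltW z0)// ge_min lexx orbT.
  apply: (@le_trans _ _ (m / 2)).
    have -> : m / (2 * Z1) * z x = m / 2 * (z x / Z1) by rewrite invfM; ring.
    rewrite ler_piMr//; first by rewrite divr_ge0// ltW.
    by rewrite ler_pdivrMr// mul1r /Z1; have := zle x Ox; lra.
  have := core x Ox ze; have [w1 _] := wabs x Ox.
  by have := ler_wpM2l (ltW d0) w1; rewrite /psi; lra.
have Cup0 : 0 < Cu + delta * (1 + K * Zm).
  by apply: ltr_wpDr Cu0; rewrite !mulr_ge0 ?ltW// ltr_wpDr// mulr_ge0// ltW.
have Clo0 : 0 < Num.min (delta / 2) (m / (2 * Z1)).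
  by rewrite lt_min !divr_gt0// mulr_gt0.
have [k [k0 kl ku]] := exp_bracket Clo0 Cup0.
have [cpsi _ _] := C2on_lin 1 delta oO c2u cw.
exists psi, k, tau; split; [exact: k0|exact: tau0|].
move=> s0 s1 L hL; split.
- exact: cpsi.
- exact: (within_continuous_lin (a := 1) (b := delta) cu cwc).
- move=> x bx; rewrite /psi (u0 x bx) /w /bend (bc_zero bz bx).
  by ring.
- move=> x Ox; apply: le_trans (psilo x Ox).
  by rewrite ler_wpM2r// ltW// (bc_pos bz Ox).
- move=> x Ox; apply: le_trans (psiup x Ox) _.
  by rewrite ler_wpM2r// ltW// (bc_pos bz Ox).
move=> s x ss Ox; have [aL h1 h2] := hL s x ss Ox.
have [d1 d2] := dMu x Ox.
have err := ellop_bound (c := ((fun i j => (L s x).1 i j - (c x).1 i j),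
  (fun j => (L s x).2 j - (c x).2 j))) (ltW tau0) h1 h2 d1 d2.
rewrite -ellop_diff -/T in err.
rewrite /psi (ellop_lin 1 delta (L s x) oO c2u cw Ox).
have eq := eqn x Ox; have uu := upos x Ox.
have zx := bc_pos bz Ox.
have p0 : 0 <= psi x.
  by apply: le_trans (psilo x Ox); rewrite mulr_ge0// ltW.
have sLu : - (sigma * ellop (L s x) u x) <= sigma * (lam * u x) + delta.
  have := le_trans err tT; rewrite ler_norml => /andP[].
  by case: sg => ->; lra.
have lw : - (`|lam| * `|w x|) <= sigma * lam * w x.
  have : `|sigma * lam * w x| = `|lam| * `|w x|.
    by rewrite !normrM; case: sg => ->; rewrite ?normrN normr1 mul1r.
  by have := ler_norm (- (sigma * lam * w x)); rewrite normrN; lra.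
have [ze|ze] := ltP (z x) eta.
  have hb := bar sigma (L s x) x sg aL Ox ze; rewrite -/w in hb.
  have {}hb := ler_wpM2l (ltW d0) hb.
  have /andP[w1 w2] := wlay x Ox ze.
  have aw : `|w x| <= 2.
    rewrite ger0_norm; first by lra.
    by apply: le_trans w1; rewrite divr_ge0// ltW.
  have : `|lam| * `|w x| <= `|lam| * 2 by rewrite ler_wpM2l.
  move=> l2; have l3 : - (`|lam| * 2) <= sigma * lam * w x by lra.
  have := ler_wpM2l (ltW d0) l3.
  have := mulr_ge0 (ltW e0) p0; rewrite /psi.
  move: hb sLu; set L1 := ellop _ u x; set L2 := ellop _ w x; lra.
have hb := bend_ellop_lower sg (ltW K0) (zle x Ox) aL Ox; rewrite -/w in hb.
have {}hb := ler_wpM2l (ltW d0) hb.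
have um := core x Ox ze; have [w1 w2] := wabs x Ox.
have aw : `|w x| <= W by rewrite ler_norml w1.
have l2 : `|lam| * `|w x| <= `|lam| * W by rewrite ler_wpM2l.
have l3 : - (`|lam| * W) <= sigma * lam * w x by lra.
have := ler_wpM2l (ltW d0) l3.
have pm : m / 2 <= psi x.
  by have := ler_wpM2l (ltW d0) w1; rewrite /psi; lra.
have := ler_wpM2l (ltW e0) pm; rewrite /psi.
move: hb sLu dQ; rewrite /Q mulNr -/Cw.
set L1 := ellop _ u x; set L2 := ellop _ w x; lra.
Qed.

End Profile.

(** * Chaining and integrating over the period *)

Section Real.
Context {R : realType}.

(** The supremum of the times reachable from 0 is reachable, by the local
    property at that supremum, and equals 1 for the same reason. *)
Lemma interval_chaining (P : R -> R -> Prop) :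
  (forall t, P t t) -> (forall t1 t2 t3, P t1 t2 -> P t2 t3 -> P t1 t3) ->
  (forall s : R, 0 <= s <= 1 -> exists2 r : R, 0 < r &
     forall t1 t2, s - r < t1 -> t1 <= t2 -> t2 < s + r -> 0 <= t1 -> t2 <= 1 -> P t1 t2) ->
  P 0 1.
Proof.
move=> Prefl Ptrans Ploc.
pose S := [set t : R | 0 <= t <= 1 /\ P 0 t].
have S0 : S 0 by split; [rewrite lexx ler01|exact: Prefl].
have Sub : has_ubound S by exists 1 => t [/andP[]].
have supS : has_sup S by split; [exists 0|exact: Sub].
pose m := sup S.
have m0 : 0 <= m by exact: (ub_le_sup Sub).
have m1 : m <= 1 by apply: ge_sup; [exists 0|move=> t [/andP[]]].
have m01 : 0 <= m <= 1 by rewrite m0.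
have [r r0 rP] := Ploc m m01.
have [t [/andP[t0 t1] Pt] mt] := sup_adherent r0 supS.
have tm : t <= m by apply: (ub_le_sup Sub); split=> //; rewrite t0.
pose u := Num.min 1 (m + r / 2).
have mu_ : m <= u by rewrite le_min m1/= lerDl divr_ge0// ltW.
have ur : u < m + r.
  by rewrite gt_min orbC ltrD2l ltr_pdivrMr// ltr_pMr// ltr1n.
have Pu : P 0 u.
  apply: Ptrans Pt _; apply: rP => //; first exact: le_trans mu_.
  by rewrite ge_min lexx.
have Su : S u by split=> //; rewrite (le_trans m0 mu_) ge_min lexx.
have um : u <= m by exact: (ub_le_sup Sub).
have um' : u = m by apply/le_anti; rewrite um mu_.
suff <- : u = 1 by [].
move: um; rewrite /u ge_min => /orP[h|].
  by apply/le_anti; rewrite ge_min lexx/= -/u um'.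
by rewrite gerDl leNgt divr_gt0.
Qed.

Lemma integral_increment (f : R -> R) (l e t1 t2 : R) :
  (@lebesgue_measure R).-integrable `[0, 1] (EFin \o f) ->
  0 <= t1 -> t1 <= t2 -> t2 <= 1 ->
  (forall s, t1 <= s <= t2 -> `|f s - l| <= e) ->
  `|\int[@lebesgue_measure R]_(s in `[0, t2]) f s -
    \int[@lebesgue_measure R]_(s in `[0, t1]) f s - l * (t2 - t1)| <= e * (t2 - t1).
Proof.
have aux (X d : R) : X <= (l + e) * d -> (l - e) * d <= X -> `|X - l * d| <= e * d.
  by move=> h1 h2; rewrite ler_norml; apply/andP; split; lra.
move=> intf t10 t12 t21 fl.
have int2 : (@lebesgue_measure R).-integrable `[0, t2] (EFin \o f).
  apply: integrableS intf => //; apply: subset_itvl; by rewrite bnd_simp.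
have int12 : (@lebesgue_measure R).-integrable `]t1, t2] (EFin \o f).
  apply: integrableS int2 => //; apply: subset_itvr; by rewrite bnd_simp.
rewrite Rintegral_itvB; [|exact: int2|by rewrite bnd_simp|by rewrite bnd_simp].
have mu12 : fine (@lebesgue_measure R `]t1, t2]%classic) = t2 - t1.
  rewrite lebesgue_measure_itv/= lte_fin; case: ltP => [//|h].
  by rewrite /= (_ : t2 = t1) ?subrr//; apply/le_anti; rewrite t12 h.
have intc (k : R) : (@lebesgue_measure R).-integrable `]t1, t2] (EFin \o (fun _ => k)).
  have ic : (@lebesgue_measure R).-integrable `[t1, t2] (EFin \o (fun _ => k)).
    apply: continuous_compact_integrable; first exact: segment_compact.
    by apply: continuous_subspaceT => s; exact: cst_continuous.
  apply: integrableS ic => //; apply: subset_itvr; by rewrite bnd_simp.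
have cstE (k : R) : \int[@lebesgue_measure R]_(s in `]t1, t2]) k = k * (t2 - t1).
  by rewrite Rintegral_cst// mu12.
have up : \int[@lebesgue_measure R]_(s in `]t1, t2]) f s <= (l + e) * (t2 - t1).
  rewrite -cstE; apply: le_Rintegral => // s /=; rewrite in_itv/= => /andP[h1 h2].
  have : t1 <= s <= t2 by rewrite h2 ltW.
  by move=> /fl; rewrite ler_norml => /andP[]; lra.
have lo : (l - e) * (t2 - t1) <= \int[@lebesgue_measure R]_(s in `]t1, t2]) f s.
  rewrite -cstE; apply: le_Rintegral => // s /=; rewrite in_itv/= => /andP[h1 h2].
  have : t1 <= s <= t2 by rewrite h2 ltW.
  by move=> /fl; rewrite ler_norml => /andP[]; lra.
exact: aux.
Qed.

End Real.

(** * The transformed operators as an admissible family *)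

Section Bridge.
Context {R : realType} {N : nat}.
Local Notation E := 'rV[R]_N.
Implicit Types (f g u : E -> R) (x p : E) (Om U : set E).

(** Tube lemma: continuity at the points (x, s0), with x in a compact set,
    gives a modulus in time that does not depend on x. *)
Lemma uniform_time_modulus Om (f : E -> R -> R) (s0 tau : R) : compact (closure Om) ->
  {within closure Om `*` [set` `[0, 1]], continuous (uncurry f)} ->
  0 <= s0 <= 1 -> 0 < tau ->
  \forall s \near s0, 0 <= s <= 1 -> forall x, closure Om x -> `|f x s - f x s0| <= tau.
Proof.
move=> cO cf s01 tau0.
have /compact_near_coveringP cov := cO.
have := cov R (nbhs s0)
  (fun s x => closure Om x -> 0 <= s <= 1 -> `|f x s - f x s0| <= tau) _.
have H : forall x, closure Om x -> \forall x' \near x & i \near s0,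
    closure Om x' -> 0 <= i <= 1 -> `|f x' i - f x' s0| <= tau.
  move=> x cx.
  have Qx : (closure Om `*` [set` `[0, 1]]) (x, s0).
    by split=> //=; rewrite in_itv.
  have cfx : uncurry f p @[p --> within (closure Om `*` [set` `[0, 1]]) (nbhs (x, s0))] -->
      f x s0.
    by move/subspace_continuousP : cf => /(_ _ Qx).
  have t2 : 0 < tau / 2 by rewrite divr_gt0.
  move/cvgrPdist_le : cfx => /(_ _ t2) [[P Q] /= [nP nQ] PQ].
  exists (P, Q) => // -[x' s] /= [Px' Qs] cx' ss.
  have h1 : `|f x s0 - f x' s| <= tau / 2.
    apply: (PQ (x', s) (conj Px' Qs)).
    by split; [exact: cx'|rewrite /= in_itv].
  have h2 : `|f x s0 - f x' s0| <= tau / 2.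
    apply: (PQ (x', s0) (conj Px' (nbhs_singleton nQ))).
    by split; [exact: cx'|rewrite /= in_itv].
  move: h1 => /ler_normlP[a1 a2]; move: h2 => /ler_normlP[b1 b2].
  by rewrite ler_norml; apply/andP; split; lra.
move=> /(_ _ H) h; apply: filterS h => s hs ss x cx; exact: hs.
Qed.

Lemma closure_cylinder Om x (s : R) : closure Om x -> closure (Om `*` [set: R]) (x, s).
Proof.
move=> clx W [[P Q] /= [nP nQ] PQ]; have [y [Oy Py]] := clx P nP.
exists (y, s); split; first by split.
by apply: PQ; split=> //=; exact: nbhs_singleton.
Qed.

Lemma has_cont_ext_slice Om (F : E * R -> R) (s : R) :
  has_cont_ext (Om `*` [set: R]) F -> has_cont_ext Om (fun x => F (x, s)).
Proof.
move=> [g [cg Fg]]; exists (fun x => g (x, s)); split; last by move=> x Ox; apply: Fg.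
have cg' : {within closure Om `*` [set: R], continuous (uncurry (fun x t => g (x, t)))}.
  have -> : uncurry (fun x t => g (x, t)) = g by apply/funext => -[].
  by apply: continuous_subspaceW cg => -[x t] [/= cx _]; exact: closure_cylinder.
exact: (within_slice (phi := fun x t => g (x, t)) (s := s) I cg').
Qed.

Lemma C21_slice Om (phi : E -> R -> R) s : C21_closure Om phi -> C2_closure Om (phi^~ s).
Proof.
move=> [c0 d e1 e2 et]; split.
- have c0' : {within closure Om `*` [set: R], continuous (uncurry phi)}.
    by apply: continuous_subspaceW c0 => -[x t] [/= cx _]; exact: closure_cylinder.
  exact: (within_slice (s := s) I c0').
- by move=> i x Ox; have [h _] := d s x Ox; exact: h.
- by move=> i; exact: (has_cont_ext_slice s (e1 i)).
- by move=> i j x Ox; have [_ [h _]] := d s x Ox; exact: h.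
- by move=> i j; exact: (has_cont_ext_slice s (e2 i j)).
Qed.

Definition coefs (a : 'I_N -> 'I_N -> E -> R -> R) (b c : 'I_N -> E -> R -> R)
    (omega s : R) x : @coef R N :=
  ((fun i j => a i j x s), (fun j => omega / (2 * pi) * b j x s + c j x s)).

Lemma stationary_solution Om (kappa lam : R) (k : E -> @coef R N) u : open Om ->
  compact (closure Om) -> C2_closure Om u -> (forall x, Om x -> 0 < u x) ->
  (forall x, (closure Om `\` Om) x -> u x = 0) ->
  (forall x, Om x -> - ellop (k x) u x = lam * u x) ->
  periodic_solution Om kappa (fun _ => k) lam (fun x _ => u x).
Proof.
move=> oO cO c2 up u0 eq; have [c0 d1 e1 d2 e2] := c2; split.
- have -> : uncurry (fun x (_ : R) => u x) = (fun p : E * R => u p.1).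
    by apply/funext => -[].
  exact: within_cst_in_time.
- by move=> s _; exact: C2_closure_C2on.
- by move=> x s _ _; exact: derivable_cst.
- by move=> x s Ox _; exact: up.
- by move=> x s bx _; exact: u0.
- by [].
- exact: derivs_le_ext.
- by move=> x s Ox _; rewrite derive1_cst mulr0 sub0r; exact: eq.
Qed.

Lemma periodic_solution_of Om a b c (omega m : R) : open Om -> compact (closure Om) ->
  principal_periodic_eigenvalue Om (Lop a b c omega) omega m ->
  exists phi, periodic_solution Om (omega / (2 * pi)) (coefs a b c omega) m phi.
Proof.
move=> oO cO [phi [c21 pos p0 per eq]]; exists phi.
have c2 s := C21_slice s c21; have [c0 d e1 e2 et] := c21; split.
- by apply: continuous_subspaceW c0 => -[x s] [/= cx _]; exact: closure_cylinder.
- by move=> s _; apply: C2_closure_C2on oO (c2 s).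
- by move=> x s Ox _; have [_ [_ h]] := d s x Ox; exact: h.
- by move=> x s Ox _; exact: pos.
- by move=> x s bx ss; exact: p0.
- by move=> x Ox; rewrite (per x 0 Ox) add0r.
- have [_ _ h1 _ h2] := c2 0; exact: derivs_le_ext.
- by move=> x s Ox ss; exact: eq.
Qed.

Lemma smooth_on_C2on U f : smooth_on U f -> C2on U f.
Proof.
move=> sm; split.
- by move=> x Ux; have [h _] := sm [::] x Ux; exact: h.
- move=> x Ux i; have [_ h] := sm [::] x Ux; have [h' _] := sm [:: i] x Ux.
  by split; [exact: h|exact: h'].
- move=> j x Ux i; have [_ h] := sm [:: j] x Ux; have [h' _] := sm [:: i; j] x Ux.
  by split; [exact: h|exact: h'].
Qed.

(** The second order coefficients at h(x, s) are D J J^T, J being the Jacobian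
    matrix of h(., s) at x, and h(., s) is onto the reference domain. The bound
    omega <= 1 makes the first order bound uniform. *)
Lemma coefs_admissible (D : R) Om0 Omt (h : E -> R -> E) a b c :
  compact (closure Om0) -> 0 <= D -> domain_maps Omt Om0 h ->
  transformed_coefficients D Omt h a b c -> uniformly_elliptic Om0 a ->
  (forall i j, {within closure Om0 `*` [set` `[0, 1]], continuous (uncurry (a i j))}) ->
  (forall j, {within closure Om0 `*` [set` `[0, 1]], continuous (uncurry (b j))}) ->
  (forall j, {within closure Om0 `*` [set` `[0, 1]], continuous (uncurry (c j))}) ->
  exists theta M : R, [/\ 0 < theta, 0 <= M,
    (forall x s, closure Om0 x -> 0 <= s <= 1 -> elliptic_at theta (fun i j => a i j x s)) &
    forall omega s x, 0 <= omega <= 1 -> 0 <= s <= 1 -> Om0 x ->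
      admissible theta M (coefs a b c omega s x)].
Proof.
move=> cO D0 [_ bij _ _] tc [theta [theta0 ell]] ca cb cc.
pose Q := closure Om0 `*` [set` `[0, (1 : R)]].
have cQ : compact Q by apply: compact_setX; [exact: cO|exact: segment_compact].
have [Ma Ma0 MaP] := uniform_family_bound
  (f := fun (ij : 'I_N * 'I_N) (p : E * R) => uncurry (a ij.1 ij.2) p)
  (fun ij => compact_abs_bound cQ (ca ij.1 ij.2)).
have [Mb Mb0 MbP] := uniform_family_bound (fun j => compact_abs_bound cQ (cb j)).
have [Mc Mc0 McP] := uniform_family_bound (fun j => compact_abs_bound cQ (cc j)).
exists theta, (Ma + Mb + Mc); split.
- exact: theta0.
- by rewrite !addr_ge0.
- by move=> x s cx ss eta; exact: ell.
move=> omega s x om ss Ox.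
have Qx : Q (x, s).
  by split; [exact: subset_closure|rewrite /= in_itv].
split.
- have [_ _ surj] := bij s; have [y Oy yx] := surj x Ox.
  have [aE _ _] := tc s y Oy.
  exists D; first exact: D0.
  exists (fun i k => pd k (hcomp h i s) y) => i j /=.
  rewrite -yx aE mulr_sumr; apply: eq_bigr => k _; by rewrite mulrA.
- by move=> eta; apply: ell; [exact: subset_closure|exact: ss].
- move=> i j /=; have := MaP (i, j) (x, s) Qx => /= h1; lra.
- move=> j /=; have /= h1 := MbP j (x, s) Qx; have /= h2 := McP j (x, s) Qx.
  apply: le_trans (ler_normD _ _) _; rewrite normrM.
  have hp : `|omega / (2 * pi)| <= 1.
    have pi1 : 1 <= 2 * (pi : R) by have := @pi_ge2 R; lra.
    have pi0 : 0 < 2 * (pi : R) by lra.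
    have [w0 w1] := andP om.
    rewrite ger0_norm; last by rewrite divr_ge0// ltW.
    by rewrite ler_pdivrMr// mul1r (le_trans w1).
  have : `|omega / (2 * pi)| * `|b j x s| <= 1 * `|b j x s| by rewrite ler_wpM2r.
  by lra.
Qed.

End Bridge.

Section Coordinate.
Context {R : realType} {N : nat}.
Local Notation E := 'rV[R]_N.
Implicit Types (f g u : E -> R) (x p : E) (Om U : set E).

(** An eigenfunction serves as boundary coordinate. By Hopf's lemma, u plus the
    square of its extended gradient is positive on the closed domain, hence
    bounded below; where u is small the gradient must carry that bound. *)
Lemma boundary_coordinate_of Om u (k : E -> @coef R N) (lam theta : R) :
  smooth_bounded_domain Om -> C2_closure Om u -> (forall x, Om x -> 0 < u x) ->
  (forall x, (closure Om `\` Om) x -> u x = 0) ->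
  0 <= lam -> (forall x, Om x -> - ellop (k x) u x = lam * u x) ->
  (forall x, Om x -> gram (k x).1) -> 0 < theta ->
  (forall x, closure Om x -> elliptic_at theta (k x).1) ->
  (forall i j, {within closure Om, continuous (fun x => (k x).1 i j)}) ->
  (forall j, {within closure Om, continuous (fun x => (k x).2 j)}) ->
  exists Mz eta c : R, 0 <= Mz /\ boundary_coordinate Om u Mz eta c.
Proof.
move=> [bd smooth] c2 up u0 lam0 eqn gr t0 ell k1 k2.
have cO := domain_closure_compact bd; have [oO On0 _ _] := bd.
have [cu _ e1 _ e2] := c2; have c2on := C2_closure_C2on oO c2.
have [Mz Mz0 dM] := derivs_le_ext cO e1 e2.
have /choice[g gP] := e1.
pose G x := 1 * u x + 1 * \sum_i g i x ^+ 2.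
have cG : {within closure Om, continuous G}.
  apply: within_continuous_lin; first exact: cu.
  have cg i : {within closure Om, continuous (fun x => g i x ^+ 2)}.
    by apply: within_continuous_sqr; have [h _] := gP i; exact: h.
  apply/subspace_continuousP => x cx.
  apply: cvg_big_sum => i; by move/subspace_continuousP : (cg i) => /(_ x cx).
have G0 x : closure Om x -> 0 < G x.
  move=> cx; have sq0 : 0 <= \sum_i g i x ^+ 2 by apply: sumr_ge0 => i _; exact: sqr_ge0.
  have [Ox|nOx] := pselect (Om x).
    by rewrite /G !mul1r ltr_wpDr// up.
  have bx : (closure Om `\` Om) x by split.
  have [U [rho [oU Ux sm [i dn0] OU]]] := smooth x bx.
  have [cgi giE] := gP i.
  have gx0 := hopf_gradient oO cO cu c2on up u0 lam0 eqn gr bx t0 (ell x cx)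
    (fun i j => (subspace_continuousP _ _).1 (k1 i j) x cx)
    (fun j => (subspace_continuousP _ _).1 (k2 j) x cx)
    oU Ux (smooth_on_C2on sm) OU dn0 cgi giE.
  rewrite /G !mul1r (u0 x bx) add0r (bigD1 i)//=; apply: ltr_pwDl.
    by rewrite exprn_even_gt0.
  by apply: sumr_ge0 => j _; exact: sqr_ge0.
have [m m0 mP] := compact_pos_min cO cG G0.
exists Mz, (m / 2), (m / 2); split; first exact: Mz0.
split.
- exact: c2on.
- exact: cu.
- exact: up.
- exact: u0.
- exact: dM.
- by rewrite divr_gt0.
- by rewrite divr_gt0.
move=> x Ox ux; have := mP x (subset_closure Ox); rewrite /G.
have -> : \sum_i pd i u x ^+ 2 = \sum_i g i x ^+ 2.
  by apply: eq_bigr => i _; have [_ ->] := gP i.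
lra.
Qed.

End Coordinate.

(** * Small frequencies *)

Section Asymptotics.
Context {R : realType} {N : nat} (Om : set 'rV[R]_N) (z : 'rV[R]_N -> R)
  (theta M Mz eta0 c0 : R) (a : 'I_N -> 'I_N -> 'rV[R]_N -> R -> R)
  (b c : 'I_N -> 'rV[R]_N -> R -> R) (lam mu : R -> R)
  (oO : open Om) (cO : compact (closure Om)) (On0 : Om !=set0)
  (t0 : 0 < theta) (M0 : 0 <= M) (Mz0 : 0 <= Mz)
  (bz : boundary_coordinate Om z Mz eta0 c0)
  (ca : forall i j, {within closure Om `*` [set` `[0, 1]], continuous (uncurry (a i j))})
  (cb : forall j, {within closure Om `*` [set` `[0, 1]], continuous (uncurry (b j))})
  (cc : forall j, {within closure Om `*` [set` `[0, 1]], continuous (uncurry (c j))})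
  (adm : forall omega s x, 0 <= omega <= 1 -> 0 <= s <= 1 -> Om x ->
    admissible theta M (coefs a b c omega s x))
  (eigen : forall s, 0 <= s <= 1 -> principal_eigenvalue Om (Lop a b c 0 s) (lam s))
  (periodic : forall omega, 0 < omega ->
    principal_periodic_eigenvalue Om (Lop a b c omega) omega (mu omega)).
Local Notation E := 'rV[R]_N.

Let z01 : (0 : R) <= (0 : R) <= 1.
Proof. by apply/andP; split; [exact: lexx|exact: ler01]. Qed.

(** One profile and one constant k serve all times s near s0 and all small
    frequencies, because the drift coefficient omega / (2 pi) b is small
    uniformly. The coefficient family L is left arbitrary in order to cover both
    the true time-dependent operator and operators frozen at one time. *)
Lemma local_profile (sigma eps s0 : R) : is_sign sigma -> 0 < eps -> 0 <= s0 <= 1 ->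
  exists psi (k r : R), [/\ 0 <= k, 0 < r, r <= 1 &
    forall t0 t1 (L : R -> E -> @coef R N),
      (forall t, t0 <= t <= t1 -> exists s omega, [/\ `|s - s0| < r, 0 <= s <= 1,
         0 <= omega, omega < r & L t = coefs a b c omega s]) ->
      test_profile Om z sigma (sigma * lam s0 + eps) k t0 t1 L psi].
Proof.
move=> sg e0 s01; have [u [c2 up u0 eqn]] := eigen s01.
have [cu _ e1 _ e2] := c2.
have [Mu Mu0 dMu] := derivs_le_ext cO e1 e2.
have [psi [k [tau [k0 tau0 tp]]]] := perturbed_profile oO cO t0 M0 Mz0 bz sg e0
  (fun x Ox => adm z01 s01 Ox) (C2_closure_C2on oO c2) cu up u0 Mu0 dMu eqn.
have t20 : 0 < tau / 2 by rewrite divr_gt0.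
have cQ : compact (closure Om `*` [set` `[0, (1 : R)]]).
  by apply: compact_setX; [exact: cO|exact: segment_compact].
have [Mb Mb0 MbP] := uniform_family_bound (fun j => compact_abs_bound cQ (@cb j)).
have na : \forall s \near s0, forall ij : 'I_N * 'I_N, 0 <= s <= 1 ->
    forall x, closure Om x -> `|a ij.1 ij.2 x s - a ij.1 ij.2 x s0| <= tau.
  apply: (@filter_forall R _ (fun (ij : 'I_N * 'I_N) s => 0 <= s <= 1 ->
    forall x, closure Om x -> `|a ij.1 ij.2 x s - a ij.1 ij.2 x s0| <= tau) (nbhs s0)).
  move=> ij; exact: (uniform_time_modulus cO (@ca ij.1 ij.2) s01 tau0).
have nc : \forall s \near s0, forall j, 0 <= s <= 1 ->
    forall x, closure Om x -> `|c j x s - c j x s0| <= tau / 2.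
  apply: (@filter_forall R _ (fun j s => 0 <= s <= 1 ->
    forall x, closure Om x -> `|c j x s - c j x s0| <= tau / 2) (nbhs s0)).
  move=> j; exact: (uniform_time_modulus cO (@cc j) s01 t20).
have /nbhs_ballP[r1 /= r10 r1P] : nbhs s0 ([set s | forall ij : 'I_N * 'I_N,
      0 <= s <= 1 -> forall x, closure Om x ->
      `|a ij.1 ij.2 x s - a ij.1 ij.2 x s0| <= tau] `&`
    [set s | forall j, 0 <= s <= 1 -> forall x, closure Om x ->
      `|c j x s - c j x s0| <= tau / 2]).
  by apply: filterI; [exact: na|exact: nc].
have Mb1 : 0 < Mb + 1 by rewrite ltr_wpDl.
pose r := Num.min 1 (Num.min r1 (tau / 2 / (Mb + 1))).
have r0 : 0 < r by rewrite !lt_min ltr01 r10 divr_gt0.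
exists psi, k, r; split; [exact: k0|exact: r0|by rewrite ge_min lexx|].
move=> s1 s2 L hL; apply: tp => t x tt Ox.
have [s [om [sr ss om0 omr ->]]] := hL t tt.
have om1 : 0 <= om <= 1.
  by rewrite om0 (le_trans (ltW omr))// /r ge_min lexx.
have [|h1 h2] := r1P s.
  rewrite -ball_normE/= distrC; apply: lt_le_trans sr _.
  by rewrite /r !ge_min lexx orbT.
have cx := subset_closure Ox.
split; first exact: adm.
- by move=> i j; exact: (h1 (i, j) ss x cx).
move=> j /=; rewrite mul0r mul0r add0r -addrA.
apply: le_trans (ler_normD _ _) _; have h3 := h2 j ss x cx.
suff : `|om / (2 * pi) * b j x s| <= tau / 2 by lra.
have hb : `|b j x s| <= Mb by apply: (MbP j (x, s)); split; rewrite //= in_itv.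
have pi1 : 1 <= 2 * (pi : R) by have := @pi_ge2 R; lra.
have pi0 : 0 < 2 * (pi : R) by lra.
rewrite normrM (ger0_norm (divr_ge0 om0 (ltW pi0))).
have h4 : om / (2 * pi) <= om.
  by rewrite ler_pdivrMr// ler_peMr.
apply: (@le_trans _ _ (om * Mb)).
  by apply: ler_pM => //; rewrite divr_ge0// ltW.
have h5 : om <= tau / 2 / (Mb + 1).
  by apply: le_trans (ltW omr) _; rewrite /r !ge_min lexx !orbT.
apply: (@le_trans _ _ (tau / 2 / (Mb + 1) * Mb)); first by rewrite ler_wpM2r.
rewrite mulrAC ler_pdivrMr// ler_wpM2l ?(ltW t20)//; lra.
Qed.

Lemma positive_not_le_small (d k : R) : 0 < d -> 0 <= k ->
  (forall kappa, 0 < kappa -> d <= 2 * k * kappa) -> False.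
Proof.
move=> d0 k0 h; have k1 : 0 < 4 * k + 4 by lra.
have := h (d / (4 * k + 4)) (divr_gt0 d0 k1).
rewrite mulrA ler_pdivlMr// leNgt => /negP; apply.
by rewrite mulrC ltr_pM2l//; lra.
Qed.

(** The eigenfunction at time s is a stationary solution for the operator frozen
    at s. Over one period it is compared with the profile built at s0, and the
    time scale kappa, free for a stationary solution, is sent to 0. *)
Lemma eigenvalue_one_sided (sigma eps s0 : R) : is_sign sigma -> 0 < eps ->
  0 <= s0 <= 1 -> exists2 r : R, 0 < r & forall s, 0 <= s <= 1 -> `|s - s0| < r ->
    sigma * lam s <= sigma * lam s0 + eps.
Proof.
move=> sg e0 s01; have [psi [k [r [k0 r0 r1 tp]]]] := local_profile sg e0 s01.
exists r => // s ss sr; rewrite leNgt; apply/negP => gap.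
have [u [c2 up u0 eqn]] := eigen ss.
pose L : R -> E -> @coef R N := fun _ => coefs a b c 0 s.
have aL t x : 0 <= t <= 1 -> Om x -> admissible theta M (L t x).
  by move=> _ Ox; apply: adm.
have tpL : test_profile Om z sigma (sigma * lam s0 + eps) k 0 1 L psi.
  by apply: tp => t _; exists s, 0; split.
have d0 : 0 < sigma * lam s - (sigma * lam s0 + eps) by lra.
apply: (@positive_not_le_small _ k d0 k0) => kappa kap0.
have ps := stationary_solution (k := coefs a b c 0 s) kappa oO cO c2 up u0 eqn.
have z1 : (0 : R) <= 1 by exact: ler01.
have step m : 0 <= m -> dominates Om z sigma m (fun x _ => u x) 0 ->
   dominates Om z sigma (m * expR ((lam s - sigma * (sigma * lam s0 + eps)) / kappa * (1 - 0)
     - sigma * (2 * k))) (fun x _ => u x) 1.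
  move=> m0; exact: (dominates_step oO cO bz sg kap0 aL ps (lexx _) z1 (lexx _) m0 k0 tpL).
have := period_growth_le0 oO cO t0 M0 Mz0 bz On0 sg (ltW kap0) aL ps step.
have -> : sigma * ((lam s - sigma * (sigma * lam s0 + eps)) / kappa * (1 - 0)
    - sigma * (2 * k)) =
    (sigma * lam s - sigma * sigma * (sigma * lam s0 + eps)) / kappa
    - sigma * sigma * (2 * k) by ring.
by rewrite (sign_sqr sg) !mul1r subr_le0 ler_pdivrMr.
Qed.

Lemma eigenvalue_near (eps s0 : R) : 0 < eps -> 0 <= s0 <= 1 ->
  exists2 r : R, 0 < r & forall s, 0 <= s <= 1 -> `|s - s0| < r ->
    `|lam s - lam s0| <= eps.
Proof.
move=> e0 s01.
have [r1 r10 h1] := eigenvalue_one_sided (or_introl erefl : is_sign (1 : R)) e0 s01.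
have [r2 r20 h2] := eigenvalue_one_sided (or_intror erefl : is_sign (- 1 : R)) e0 s01.
exists (Num.min r1 r2); first by rewrite lt_min r10.
move=> s ss; rewrite lt_min => /andP[a1 a2].
have := h1 s ss a1; have := h2 s ss a2; rewrite !mul1r !mulN1r => g1 g2.
by rewrite ler_norml; apply/andP; split; lra.
Qed.

Lemma eigenvalue_integrable : (@lebesgue_measure R).-integrable `[0, 1] (EFin \o lam).
Proof.
apply: continuous_compact_integrable; first exact: segment_compact.
apply/subspace_continuousP => s0 /=; rewrite in_itv/= => s01.
apply/cvgrPdist_le => e e0; have [r r0 h] := eigenvalue_near e0 s01.
exists r => //= s sr; rewrite in_itv/= => ss.
have : `|lam s - lam s0| <= e by apply: h => //; rewrite distrC.
by rewrite distrC.
Qed.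

Let primitive (t : R) : R := \int[@lebesgue_measure R]_(s in `[0, t]) lam s.

Lemma primitive_increment (eps s0 : R) : 0 < eps -> 0 <= s0 <= 1 ->
  exists2 r : R, 0 < r & forall t1 t2, s0 - r < t1 -> t1 <= t2 -> t2 < s0 + r ->
    0 <= t1 -> t2 <= 1 -> `|primitive t2 - primitive t1 - lam s0 * (t2 - t1)| <= eps * (t2 - t1).
Proof.
move=> e0 s01; have [r r0 h] := eigenvalue_near e0 s01.
exists r => // t1 t2 h1 t12 h2 t10 t21.
apply: (integral_increment eigenvalue_integrable t10 t12 t21) => s /andP[s1 s2].
apply: h; first by rewrite (le_trans t10 s1) (le_trans s2 t21).
by rewrite ltr_norml; apply/andP; split; lra.
Qed.

(** The main part of the exponent is of order 1 / omega; the constant k, which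
    collects the losses at the changes of profile, does not depend on omega. This
    relation between t1 and t2 is transitive, hence can be chained from short
    intervals to a whole period. *)
Definition exponent_bound (sigma eps t1 t2 : R) := exists k w : R, [/\ 0 <= k, 0 < w, w <= 1 &
  forall omega phi m, 0 < omega -> omega < w ->
    periodic_solution Om (omega / (2 * pi)) (coefs a b c omega) (mu omega) phi ->
    0 <= m -> dominates Om z sigma m phi t1 ->
    dominates Om z sigma (m * expR ((mu omega * (t2 - t1) - (primitive t2 - primitive t1) -
      sigma * eps * (t2 - t1)) / (omega / (2 * pi)) - sigma * k)) phi t2].

Lemma exponent_bound_refl sigma eps t : exponent_bound sigma eps t t.
Proof.
exists 0, 1; split=> // omega phi m _ _ _ _ h.
by rewrite !subrr !mulr0 !subr0 mul0r expR0 mulr1.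
Qed.

Lemma exponent_bound_trans sigma eps t1 t2 t3 :
  exponent_bound sigma eps t1 t2 -> exponent_bound sigma eps t2 t3 ->
  exponent_bound sigma eps t1 t3.
Proof.
move=> [k1 [w1 [k10 w10 w11 h1]]] [k2 [w2 [k20 w20 w21 h2]]].
exists (k1 + k2), (Num.min w1 w2); split.
- exact: addr_ge0.
- by rewrite lt_min w10.
- by rewrite ge_min w11.
move=> omega phi m om0; rewrite lt_min => /andP[ow1 ow2] ps m0 dom.
have := h2 omega phi _ om0 ow2 ps (mulr_ge0 m0 (expR_ge0 _)) (h1 omega phi m om0 ow1 ps m0 dom).
set A := expR (_ - sigma * k1); set B := expR (_ - sigma * k2).
set C := expR (_ - sigma * (k1 + k2)); suff -> : m * C = m * A * B by [].
by rewrite -mulrA /A /B -expRD /C; congr (_ * expR _); ring.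
Qed.

Lemma exponent_bound_local sigma eps s0 : is_sign sigma -> 0 < eps -> 0 <= s0 <= 1 ->
  exists2 r : R, 0 < r & forall t1 t2, s0 - r < t1 -> t1 <= t2 -> t2 < s0 + r ->
    0 <= t1 -> t2 <= 1 -> exponent_bound sigma eps t1 t2.
Proof.
move=> sg e0 s01; have e20 : 0 < eps / 2 by rewrite divr_gt0.
have [psi [k [r1 [k0 r10 r11 tp]]]] := local_profile sg e20 s01.
have [r2 r20 inc] := primitive_increment e20 s01.
exists (Num.min r1 r2); first by rewrite lt_min r10.
move=> t1 t2 h1 t12 h2 t1_0 t2_1.
have [m1 m2] : Num.min r1 r2 <= r1 /\ Num.min r1 r2 <= r2 by rewrite !ge_min !lexx orbT.
exists (2 * k), r1; split=> //; first by rewrite mulr_ge0.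
move=> omega phi m om0 omr ps m0 dom.
have pi0 : 0 < 2 * (pi : R) by have := @pi_ge2 R; lra.
have kap0 : 0 < omega / (2 * pi) by rewrite divr_gt0.
have tpL : test_profile Om z sigma (sigma * lam s0 + eps / 2) k t1 t2 (coefs a b c omega) psi.
  apply: tp => t /andP[tt1 tt2]; exists t, omega; split=> //; last exact: ltW.
    by rewrite ltr_norml; apply/andP; split; lra.
  by rewrite (le_trans t1_0 tt1) (le_trans tt2 t2_1).
have aL s x : 0 <= s <= 1 -> Om x -> admissible theta M (coefs a b c omega s x).
  by move=> ss Ox; apply: adm => //; rewrite (ltW om0) (le_trans (ltW omr) r11).
have := dominates_step oO cO bz sg kap0 aL ps t1_0 t12 t2_1 m0 k0 tpL dom.
apply: (dominates_weaken bz).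
have mono e e' : sigma * e <= sigma * e' -> sigma * (m * expR e) <= sigma * (m * expR e').
  rewrite !(mulrCA sigma) => ee; apply: ler_wpM2l => //.
  by case: sg ee => ->; rewrite ?mul1r ?mulN1r ?lerN2 ler_expR.
apply: mono.
have {inc} : `|primitive t2 - primitive t1 - lam s0 * (t2 - t1)| <= eps / 2 * (t2 - t1).
  by apply: inc => //; lra.
move=> /ler_normlP[]; move: (primitive t2 - primitive t1) (t2 - t1) => X T i1 i2.
set kap := omega / _.
have -> : sigma * ((mu omega * T - X - sigma * eps * T) / kap - sigma * (2 * k)) =
  (sigma * mu omega * T - sigma * X - (sigma * sigma) * eps * T) / kap
  - sigma * sigma * (2 * k) by ring.
have -> : sigma * ((mu omega - sigma * (sigma * lam s0 + eps / 2)) / kap * T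
    - sigma * (2 * k)) =
  (sigma * mu omega * T - sigma * sigma * (sigma * lam s0 + eps / 2) * T) / kap
  - sigma * sigma * (2 * k) by ring.
rewrite (sign_sqr sg) !mul1r lerD2r ler_pM2r ?invr_gt0//.
by case: sg => ->; lra.
Qed.

(** Chaining over [0, 1] and the invariance over one period bound the total
    exponent; multiplication by kappa = omega / (2 pi) makes the accumulated
    constant k negligible. *)
Lemma eigenvalue_bound (sigma eps : R) : is_sign sigma -> 0 < eps ->
  exists2 w : R, 0 < w & forall omega, 0 < omega -> omega < w ->
    sigma * mu omega <= sigma * \int[@lebesgue_measure R]_(s in `[0, 1]) lam s + 2 * eps.
Proof.
move=> sg e0.
have [k [w [k0 w0 w1 h]]] : exponent_bound sigma eps 0 1.
  apply: (interval_chaining (P := exponent_bound sigma eps)).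
  - exact: exponent_bound_refl.
  - exact: exponent_bound_trans.
  - by move=> s s01; exact: exponent_bound_local.
have k1 : 0 < k + 1 by rewrite ltr_wpDl.
exists (Num.min w (eps / (k + 1))); first by rewrite lt_min w0 divr_gt0.
move=> omega om0; rewrite lt_min => /andP[ow1 ow2].
have pi0 : 1 <= 2 * (pi : R) by have := @pi_ge2 R; lra.
have kap0 : 0 < omega / (2 * pi) by rewrite divr_gt0//; lra.
have kap1 : omega / (2 * pi) <= omega by rewrite ler_pdivrMr ?ler_peMr//; lra.
have [phi ps] := periodic_solution_of oO cO (periodic om0).
have aL s x : 0 <= s <= 1 -> Om x -> admissible theta M (coefs a b c omega s x).
  by move=> ss Ox; apply: adm => //; rewrite (ltW om0) (le_trans (ltW ow1) w1).
have := period_growth_le0 oO cO t0 M0 Mz0 bz On0 sg (ltW kap0) aL ps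
  (fun m m0 dm => h omega phi m om0 ow1 ps m0 dm).
have -> : primitive 0 = 0 by rewrite /primitive set_itv1 Rintegral_set1.
rewrite -/(primitive 1) !subr0 !mulr1; move: (primitive 1) => X.
set kap := omega / _ in kap0 kap1 *.
have -> : sigma * ((mu omega - X - sigma * eps) / kap - sigma * k) =
  (sigma * mu omega - sigma * X - sigma * sigma * eps) / kap - sigma * sigma * k by ring.
rewrite (sign_sqr sg) !mul1r subr_le0 ler_pdivrMr//.
have : k * kap <= (k + 1) * omega.
  by apply: ler_pM => //; [exact: ltW|rewrite lerDl].
move: ow2; rewrite ltr_pdivlMr// mulrC; lra.
Qed.

End Asymptotics.

Unset Implicit Arguments.
Theorem theorem5 (R : realType) (N : nat) (D alpha : R)
    (Om0 : set 'rV[R]_N) (Omt : R -> set 'rV[R]_N)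
    (h : 'rV[R]_N -> R -> 'rV[R]_N)
    (a : 'I_N -> 'I_N -> 'rV[R]_N -> R -> R)
    (b c : 'I_N -> 'rV[R]_N -> R -> R)
    (lambda0 : R -> R -> R) (mu : R -> R) :
  (0 < N)%N ->
  0 < D ->
  smooth_bounded_domain Om0 ->
  periodic_domains Omt ->
  domain_maps Omt Om0 h ->
  transformed_coefficients D Omt h a b c ->
  uniformly_elliptic Om0 a ->
  0 < alpha < 1 ->
  (forall i j, C1holder alpha Om0 (a i j)) ->
  (forall j, C1holder alpha Om0 (b j)) ->
  (forall j, C1holder alpha Om0 (c j)) ->
  (forall s omega : R, 0 <= s <= 1 -> 0 <= omega ->
     principal_eigenvalue Om0 (Lop a b c omega s) (lambda0 s omega)) ->
  (forall omega : R, 0 < omega ->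
     principal_periodic_eigenvalue Om0 (Lop a b c omega) omega (mu omega)) ->
  (@lebesgue_measure R).-integrable `[0, 1] (fun s => (lambda0 s 0)%:E) /\
  mu omega @[omega --> 0^'+] -->
    \int[@lebesgue_measure R]_(s in `[0, 1]) lambda0 s 0.
Proof.
move=> _ D0 sbd _ dm tc ue _ ha hb hc eig per.
have [bd _] := sbd; have cO := domain_closure_compact bd; have [oO On0 _ _] := bd.
have ca i j : {within closure Om0 `*` [set` `[0, 1]], continuous (uncurry (a i j))}.
  by have [] := ha i j.
have cb j : {within closure Om0 `*` [set` `[0, 1]], continuous (uncurry (b j))}.
  by have [] := hb j.
have cc j : {within closure Om0 `*` [set` `[0, 1]], continuous (uncurry (c j))}.
  by have [] := hc j.
have [theta [M [t0 M0 ell adm]]] := coefs_admissible cO (ltW D0) dm tc ue ca cb cc.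
have z01 : (0 : R) <= (0 : R) <= 1 by apply/andP; split; [exact: lexx|exact: ler01].
have eig0 s : 0 <= s <= 1 -> principal_eigenvalue Om0 (Lop a b c 0 s) (lambda0 s 0).
  by move=> ss; exact: eig.
have [z [c2z pz z0 eqz]] := eig0 0 z01.
have sz := stationary_solution (k := coefs a b c 0 0) 1 oO cO c2z pz z0 eqz.
have lam0 := periodic_solution_ge0 oO cO On0 ler01 (fun s x _ Ox => adm 0 0 x z01 z01 Ox) sz.
have i01 : [set` `[0, (1 : R)]] 0 by rewrite /= in_itv.
have [Mz [eta [c0 [Mz0 bz]]]] : exists Mz eta c0 : R,
    0 <= Mz /\ boundary_coordinate Om0 z Mz eta c0.
  apply: (boundary_coordinate_of (k := coefs a b c 0 0) sbd c2z pz z0 lam0 eqz _ t0).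
  - by move=> x Ox; exact: adm_gram (adm 0 0 x z01 z01 Ox).
  - by move=> x cx; exact: ell.
  - by move=> i j; exact: (within_slice (phi := a i j) i01 (ca i j)).
  - move=> j; have -> : (fun x => (coefs a b c 0 0 x).2 j) =
        (fun x => 0 / (2 * pi) * b j x 0 + 1 * c j x 0).
      by apply/funext => x /=; rewrite mul1r.
    exact: (within_continuous_lin (within_slice (phi := b j) i01 (cb j))
      (within_slice (phi := c j) i01 (cc j))).
have bound := eigenvalue_bound oO cO On0 t0 M0 Mz0 bz ca cb cc adm eig0 per.
split.
  exact: (eigenvalue_integrable oO cO On0 t0 M0 Mz0 bz ca cb cc adm eig0).
apply/cvgrPdist_le => e e0.
have e20 : 0 < e / 2 by rewrite divr_gt0.
have [w1 w10 h1] := bound 1 _ (or_introl erefl) e20.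
have [w2 w20 h2] := bound (- 1) _ (or_intror erefl) e20.
exists (Num.min w1 w2) => /=; first by rewrite lt_min w10.
move=> om; rewrite /= sub0r normrN => omw om0; move: omw.
rewrite gtr0_norm// lt_min => /andP[a1 a2].
have := h1 om om0 a1; have := h2 om om0 a2; rewrite !mul1r !mulN1r.
move: (\int[_]_(s in _) _) (mu om) => X m g1 g2.
by rewrite ler_norml; apply/andP; split; lra.
Qed.
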